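(* Let $n\ge1$, $\alpha\in(\mathbb{N}\cup\{0\})^n$, let $x^0\in\mathbb{G}^{n+1}_\alpha$ be a Riemannian point, and let $\phi\in\mathcal{R}^0_\alpha$ be the generalized spherical coordinate of a non-trivial geodesic $x(t)=x(t;\phi)$ starting at $x^0$ with initial covector $p^0(\phi)$. Let $\tau=\tau(\phi):=\min\{\tau_j(\phi): j\in J\}$. Then $0<\tau\le t_{\operatorname{con}}$, where $t_{\operatorname{con}}$ is the conjugate time of this geodesic. Furthermore, equality $\tau=t_{\operatorname{con}}$ holds if and only if there is $j\in J$ such that $\tau=\tau_j$ and $\phi_j=\pi_{\alpha_j}/2$ or $\phi_j=3\pi_{\alpha_j}/2$.
   Context: Grushin space: for $n\ge1$ and $\alpha=(\alpha_1,\dots,\alpha_n)\in(\mathbb{N}\cup\{0\})^n$, $\mathbb{G}^{n+1}_\alpha$ is $\mathbb{R}^{n+1}$ with the sub-Riemannian structure generated by $X_j=\xi_j\partial_{x_j}$, $j=1,\dots,n+1$, where $\xi_j(x)=\prod_{i=1}^{j-1}x_i^{\alpha_i}$ (empty product $=1$), with its Carnot–Carathéodory distance. $H(x,p)=\tfrac12\sum_{j=1}^{n+1}\xi_j(x)^2p_j^2$. A geodesic with initial point $x^0$ and covector $p^0$ is the projection $x(t)$ of the solution of $x_j'=\xi_j(x)^2p_j$, $p_j'=-\partial H/\partial x_j$, $x(0)=x^0$, $p(0)=p^0$. The exponential map is $\exp_{x^0}(p^0):=x(1)$, so $\exp_{x^0}(tp^0)=x(t)$; the (first) conjugate time of the geodesic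 is $t_{\operatorname{con}}:=\inf\{t>0:\exp_{x^0}\text{ has a critical point at }tp^0\}$. $J:=\{j\in\{1,\dots,n\}:\alpha_j\neq0\}$; $x^0$ is Riemannian if $x^0_j\neq0$ for all $j\in J$. Generalized trigonometric functions: for real $a\ge1$, $\pi_a:=2\int_0^1(1-t^{2a})^{-1/2}dt$; $\sin_a$ is the inverse of $s\mapsto\int_0^s(1-t^{2a})^{-1/2}dt$ on $[0,\pi_a/2]$, extended by $\sin_a(s)=\sin_a(\pi_a-s)$ to $[0,\pi_a]$, oddly to $[-\pi_a,\pi_a]$ and $2\pi_a$-periodically to $\mathbb{R}$; $\cos_a:=\sin_a'$. $\rho_\theta(s):=|s|^{\theta-1}s$. Generalized spherical coordinates: let $\tilde\alpha_j=\alpha_j$ if $j\in J$, $\tilde\alpha_j=1$ otherwise; $\tilde x^0_j=x^0_j$ if $j\in J$, $\tilde x^0_j=1$ otherwise. For $\phi\in\mathcal{R}_\alpha:=\prod_{j\le n-1}[0,\pi_{\tilde\alpha_j}]\times[0,2\pi_{\tilde\alpha_n})$ put $\delta_j=\rho_{\tilde\alpha_j}(\sin_{\tilde\alpha_j}(\phi_j)/\tilde x^0_j)$, $p^0_j(\phi)=\cos_{\tilde\alpha_j}(\phi_j)\prod_{i<j}\delta_i$ for $j\le n$ and $p^0_{n+1}(\phi)=\prod_{i\le n}\delta_i$; this parametrizes $\{p^0:H(x^0,p^0)=1/2\}$. $\mathcal{R}^0_\alpha:=\{\phi\in\mathcal{R}_\alpha:\sin_{\tilde\alpha_j}(\phi_j)\neq0\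 \forall j\}$. For $j\in J$, $\omega_j:=\frac{\sin_{\alpha_j}(\phi_j)}{x^0_j}\prod_{i<j}\delta_i$, and $\tau_j(\phi):=\min\{t>0:\ |\omega_j|\int_0^t\xi_j(x(s))^2ds=\pi_{\alpha_j}\}$.
   Formalization: It is assumed that some α_j is nonzero (J is nonempty): for α = 0 the minimum defining τ is over the empty set, and with τ = +∞ the stated equivalence would fail in Euclidean space, where the conjugate time is also infinite. *)

(* Defs.v *)
From HB Require Import structures.
From mathcomp Require Import all_boot all_order all_algebra.
From mathcomp Require Import all_classical all_reals all_analysis.

Set Implicit Arguments.
Unset Strict Implicit.
Unset Printing Implicit Defensive.

Import Order.TTheory GRing.Theory Num.Theory.
Import numFieldNormedType.Exports.

Local Open Scope classical_set_scope.
Local Open Scope ring_scope.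

(* Indexing convention: the paper's coordinates 1..n+1 are our 0-based
   indices 'I_(n.+1); the paper's j in {1..n} (for alpha, phi, J) is our
   j : 'I_n, i.e. paper index = our index + 1. *)

Section Grushin.
Variable R : realType.

Definition gF (a : nat) (s : R) : R :=
  Rintegral (@lebesgue_measure R) `[0, s]
    (fun t => (Num.sqrt (1 - t ^+ (2 * a)))^-1).

Definition gpi (a : nat) : R := 2 * gF a 1.

Definition gsin_base (a : nat) (u : R) : R :=
  xget 0 [set s : R | 0 <= s <= 1 /\ gF a s = u].

(* sin_a on R: symmetric about pi_a/2 on [0,pi_a], odd on [-pi_a,pi_a],
   2 pi_a periodic. *)
Definition gsin (a : nat) (u : R) : R :=
  let v := u - 2 * gpi a * (Num.floor ((u + gpi a) / (2 * gpi a)))%:~R in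
  let w := `|v| in
  let w' := if w <= gpi a / 2 then w else gpi a - w in
  (if v < 0 then -1 else 1) * gsin_base a w'.

Definition gcos (a : nat) (u : R) : R := derive1 (gsin a) u.

Definition grho (th : nat) (s : R) : R := `|s| ^+ (th - 1) * s.

Variable n : nat.
Variable alpha : 'I_n -> nat.

Definition widx (i : 'I_n) : 'I_n.+1 := widen_ord (leqnSn n) i.

Definition xi (x : 'rV[R]_n.+1) (j : 'I_n.+1) : R :=
  \prod_(i < n | (i < j)%N) x ord0 (widx i) ^+ alpha i.

Definition Ham (x p : 'rV[R]_n.+1) : R :=
  2^-1 * \sum_(j < n.+1) (xi x j) ^+ 2 * (p ord0 j) ^+ 2.

Definition ham_sol (x p : R -> 'rV[R]_n.+1) : Prop :=
  forall (t : R) (j : 'I_n.+1),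
    is_derive t 1 (fun s => x s ord0 j) ((xi (x t) j) ^+ 2 * p t ord0 j) /\
    is_derive t 1 (fun s => p s ord0 j)
      (- 'D_(delta_mx ord0 j) (fun y => Ham y (p t)) (x t)).

Definition geod (x0 p0 : 'rV[R]_n.+1) (t : R) : 'rV[R]_n.+1 :=
  xget 0 [set y | exists x p : R -> 'rV[R]_n.+1,
            [/\ ham_sol x p, x 0 = x0, p 0 = p0 & y = x t]].

Definition expmap (x0 : 'rV[R]_n.+1) (p0 : 'rV[R]_n.+1) : 'rV[R]_n.+1 :=
  geod x0 p0 1.

Definition critical_point (f : 'rV[R]_n.+1 -> 'rV[R]_n.+1)
    (q : 'rV[R]_n.+1) : Prop :=
  differentiable f q /\ \det (jacobian f q) = 0.

(* first conjugate time (inf of empty set = +oo) *)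
Definition tcon (x0 p0 : 'rV[R]_n.+1) : \bar R :=
  ereal_inf (EFin @` [set t : R | 0 < t /\ critical_point (expmap x0) (t *: p0)]).

Definition Jset : set 'I_n := [set j | alpha j != 0%N].

Definition riemannian (x0 : 'rV[R]_n.+1) : Prop :=
  forall j : 'I_n, alpha j != 0%N -> x0 ord0 (widx j) != 0.

Definition talpha (j : 'I_n) : nat := if alpha j == 0%N then 1%N else alpha j.
Definition tx (x0 : 'rV[R]_n.+1) (j : 'I_n) : R :=
  if alpha j == 0%N then 1 else x0 ord0 (widx j).

Definition Rcoord (phi : 'I_n -> R) : Prop :=
  forall j : 'I_n,
    if (j < n.-1)%N then 0 <= phi j <= gpi (talpha j)
    else 0 <= phi j < 2 * gpi (talpha j).

Definition Rcoord0 (phi : 'I_n -> R) : Prop :=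
  Rcoord phi /\ forall j : 'I_n, gsin (talpha j) (phi j) != 0.

Definition gdelta (x0 : 'rV[R]_n.+1) (phi : 'I_n -> R) (i : 'I_n) : R :=
  grho (talpha i) (gsin (talpha i) (phi i) / tx x0 i).

Definition p0phi (x0 : 'rV[R]_n.+1) (phi : 'I_n -> R) : 'rV[R]_n.+1 :=
  \row_(j < n.+1)
    match (insub (nat_of_ord j) : option 'I_n) with
    | Some k => gcos (talpha k) (phi k) *
                \prod_(i < n | (i < k)%N) gdelta x0 phi i
    | None => \prod_(i < n) gdelta x0 phi i
    end.

Definition gomega (x0 : 'rV[R]_n.+1) (phi : 'I_n -> R) (j : 'I_n) : R :=
  gsin (alpha j) (phi j) / x0 ord0 (widx j) *
  \prod_(i < n | (i < j)%N) gdelta x0 phi i.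

(* tau_j(phi) = min { t > 0 : |omega_j| \int_0^t xi_j(x(s))^2 ds = pi_{alpha_j} }
   (taken as an infimum in \bar R, which is the minimum when the set is
   nonempty, and +oo otherwise) *)
Definition tauj (x0 : 'rV[R]_n.+1) (phi : 'I_n -> R) (j : 'I_n) : \bar R :=
  ereal_inf (EFin @` [set t : R | 0 < t /\
     `|gomega x0 phi j| *
       Rintegral (@lebesgue_measure R) `[0, t]
         (fun s => (xi (geod x0 (p0phi x0 phi) s) (widx j)) ^+ 2)
     = gpi (alpha j)]).

Definition tau (x0 : 'rV[R]_n.+1) (phi : 'I_n -> R) : \bar R :=
  ereal_inf (tauj x0 phi @` Jset).

End Grushin.

(* Main.v *)
Require Import Defs.
From HB Require Import structures.
From mathcomp Require Import all_boot all_order all_algebra.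
From mathcomp Require Import all_classical all_reals all_analysis.
From mathcomp Require Import measurable_realfun.
From mathcomp Require Import ring lra zify.

Set Implicit Arguments.
Unset Strict Implicit.
Unset Printing Implicit Defensive.

Import Order.TTheory GRing.Theory Num.Theory.
Import numFieldNormedType.Exports.
Local Open Scope classical_set_scope.
Local Open Scope ring_scope.

(** The Hamiltonian flow is integrated level by level. The reduced energies
    [E_k = p_k^2 + x_k^(2 a_k) E_(k+1)] are conserved, so in the clock
    [s_k = \int xi_k^2] the coordinate [x_k] runs along the one-dimensional orbit
    [A sin_a (omega s_k + phi)], and by the virial identity the next clock
    [s_(k+1) = \int x_k^(2 a_k) ds_k] is an explicit function of [s_k, p_k, E_(k+1)].
    Hence the exponential map is explicit, and differentiable where [p_(n+1) <> 0].

    For a variation of the initial covector put [B_k = E_k ds_k + s_k dE_k / 2]. The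
    Gauss lemma at level [k] reads [p_k dx_k = B_k - B_(k+1)], and if [dE_k = ds_k = 0]
    then [dx_k] is a multiple of [dp_k]. So the Jacobian is triangular up to the total
    length, and it is singular iff one of these multiples vanishes. With [psi] the angle
    reached, this is [tan psi - psi = tan phi - phi]; as [tan - id] is increasing on each
    branch and drops by [pi_a] over a half period, [|psi - phi| >= pi_a], with equality
    iff [cos phi = 0]. *)

(** * One-variable calculus *)

(** Conjugate times are read off the time-one map at the covector [t *: p0], whereas the [tauj] are
    read off the trajectory of [p0] itself up to time [t]; homogeneity of the Hamiltonian carries
    clocks, energies and phases from one picture to the other. Since [geod] selects a solution by
    choice, explicit formulas can replace it only after existence and uniqueness are both known.
    Dividing by E_(k+1), and differentiating the inverse of cos_a, require E_(k+1) > 0 at every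
    level. This is where the Riemannian initial point and the nonvanishing sines of the coordinates
    enter. Levels with exponent 0 never become singular: their multiple is the clock itself, which
    is positive. On a level of J the angle travelled is |omega_j| s_j, which is 0 at time 0 and
    continuous, so an angle of at least pi_a means that the threshold defining [tauj] has already
    been met. The phase rebuilt from (p, E) need not be phi_j, but it has the same |sin_a|, and its
    cosine vanishes exactly when that of phi_j does; nothing finer is needed. *)

Section calculus.
Variable R : realType.
Implicit Types (f g F G : R -> R).

Lemma is_derive_continuous f x df : is_derive x (1:R) f df -> {for x, continuous f}.
Proof. by move=> [dfx _]; apply: differentiable_continuous; apply/derivable1_diffP. Qed.

Lemma is_derive_within f df (A : set R) :
  (forall x, is_derive x (1:R) f (df x)) -> {within A, continuous f}.
Proof.
move=> h; apply: continuous_subspaceT => x; exact: is_derive_continuous (h x).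
Qed.

Lemma mean_value f df a b : a < b -> (forall x, is_derive x (1:R) f (df x)) ->
  exists2 c, a < c < b & f b - f a = df c * (b - a).
Proof.
move=> ab h; have [] := @MVT R f df a b ab (fun x _ => h x) (is_derive_within h).
by move=> c; rewrite in_itv/= => ? ?; exists c.
Qed.

Lemma derive_pos_lt f df : (forall x, is_derive x (1:R) f (df x)) ->
  (forall x, 0 < df x) -> {mono f : x y / x < y}.
Proof.
move=> h p; apply/leW_mono/le_mono => x y xy.
have [c _ e] := mean_value xy h.
by rewrite -subr_gt0 e mulr_gt0 ?subr_gt0.
Qed.

Lemma derive_zero_cst f : (forall x, is_derive x (1:R) f 0) -> forall x y, f x = f y.
Proof.
move=> h x y; wlog xy : x y / x < y.
  move=> hw; case: (ltgtP x y) => [||->//]; first exact: hw.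
  by move/hw.
by have [c _] := mean_value xy h; rewrite mul0r => /subr0_eq.
Qed.

Lemma antiderivative_unique F G f : (forall x, is_derive x (1:R) F (f x)) ->
  (forall x, is_derive x (1:R) G (f x)) -> forall x0, F x0 = G x0 -> F =1 G.
Proof.
move=> hF hG x0 e x.
have h y : is_derive y (1:R) (F - G) 0.
  by apply: is_derive_eq; rewrite subrr.
have := derive_zero_cst h x x0; rewrite !fctE e subrr => /subr0_eq; exact.
Qed.

Lemma antiderivative_exists f : continuous f ->
  exists F, (forall x, is_derive x (1:R) F (f x)) /\ F 0 = 0.
Proof.
move=> cf.
pose I (M x : R) : R := \int[@lebesgue_measure R]_(t in `[(- M), x]) f t.
have intf (a b : R) : (@lebesgue_measure R).-integrable `[a, b] (EFin \o f).
  apply: continuous_compact_integrable; first exact: segment_compact.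
  exact: continuous_subspaceT.
have dI (M x : R) : - M < x -> is_derive x (1:R) (I M) (f x).
  move=> Mx.
  have [d e] : derivable (I M) x 1 /\ derive1 (I M) x = f x.
    exact: (@continuous_FTC1_closed R f (- M) x (x + 1)) (ltr_pwDr ltr01 (lexx _)) (intf _ _) Mx
      (cf x).
  by split; [exact: d | rewrite -derive1E; exact: e].
(* The lower endpoint moves with [x], so that one formula covers the whole line. By [FE] any
   endpoint further to the left gives the same value, hence near a given point a fixed endpoint can
   be used and the fundamental theorem applies. *)
pose F (x : R) := I (`|x| + 1) x - I (`|x| + 1) 0.
have FE (M x : R) : `|x| + 1 <= M -> F x = I M x - I M 0.
  move=> hM; pose m : R := `|x| + 1.
  have mM : - M <= - m by rewrite lerN2.
  have key (y : R) : - m <= y -> I M y = \int[@lebesgue_measure R]_(t in `[(- M),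
    (- m)]) f t + \int[@lebesgue_measure R]_(t in `](- m), y]) f t.
    move=> my.
    have e := @Rintegral_itvB R f (BLeft (- M)) (BRight y) (- m) (intf _ _) _ _.
    rewrite /I -e ?bnd_simp //. ring.
  have key2 (y : R) : I m y = \int[@lebesgue_measure R]_(t in `](- m), y]) f t.
    rewrite /I (@Rintegral_itv_obnd_cbnd _ (- m) (BRight y)) //.
    by apply: integrableS (intf (- m) y) => //; apply: subset_itvr; rewrite ?bnd_simp.
  have mx : - m <= x by rewrite /m; have ? := lerNnormlW (lexx `|x|); lra.
  have m0 : - m <= 0 by rewrite /m; have ? := normr_ge0 x; lra.
  rewrite /F -/m !key // !key2; ring.
exists F; split; last by rewrite /F subrr.
move=> x.
have h : is_derive x (1:R) (fun y => I (`|x| + 2) y - I (`|x| + 2) 0) (f x).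
  have ? : is_derive x (1:R) (I (`|x| + 2)) (f x).
    by apply: dI; have ? := lerNnormlW (lexx `|x|); lra.
  by apply: is_derive_eq; rewrite subr0.
apply: (near_eq_is_derive _ h).
near=> y; rewrite (@FE (`|x| + 2)) //.
suff : `|x - y| < 1 by have := ler_normD (y - x) x; rewrite subrK distrC => *; lra.
by near: y; apply: (@cvgr_dist_lt _ _ _ _ _ id) => //; apply: cvg_id.
Unshelve. all: end_near. Qed.

Lemma inverse_exists F f (m : R) : 0 < m ->
  (forall x, is_derive x (1:R) F (f x)) -> (forall x, m <= f x) ->
  exists G, [/\ cancel F G, cancel G F & forall y, is_derive y (1:R) G (f (G y))^-1].
Proof.
move=> m0 dF mf.
have f0 x : 0 < f x by apply: lt_le_trans (mf x).
have F_lt := derive_pos_lt dF f0.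
have Finj : injective F by apply: inc_inj; apply: le_mono => x y; rewrite F_lt.
have up (x y : R) : x <= y -> F x + m * (y - x) <= F y.
  rewrite le_eqVlt => /orP[/eqP->|xy]; first by rewrite subrr mulr0 addr0.
  have [c _ e] := mean_value xy dF.
  by rewrite addrC -lerBrDr e ler_wpM2r // subr_ge0 ltW.
have surj (y : R) : exists x, F x = y.
  (* Slope at least [m] makes [F] move by at least |y - F 0| over a length [b], so [y] lies between
     F (-b) and F b. *)
  pose b := `|y - F 0| / m.
  have b0 : 0 <= b by rewrite divr_ge0 // ltW.
  have h1 := up 0 b b0; have h2 := up (- b) 0; rewrite oppr_le0 in h2; move/(_ b0) : h2 => h2.
  have eb : m * b = `|y - F 0| by rewrite /b mulrC divfK // gt_eqF.
  rewrite subr0 eb in h1; rewrite sub0r opprK eb in h2.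
  have := @IVT R F (- b) b y _ (is_derive_within dF) _.
  case; first by lra.
    have ? := ler_norm (y - F 0); have ? := lerNnormlW (lexx `|y - F 0|).
    by rewrite ge_min le_max; apply/andP; split; apply/orP; [left|right]; lra.
  by move=> c _ <-; exists c.
have [G GK] := choice surj.
have FK : cancel F G by move=> x; apply: Finj; rewrite GK.
exists G; split => // y.
rewrite -[in is_derive y](GK y).
apply: is_derive_inverse => //.
- by near=> z; apply: FK.
- by near=> z; apply: is_derive_continuous (dF z).
- by rewrite gt_eqF.
Unshelve. all: end_near. Qed.

End calculus.

Section pointwise_derivatives.
Variable R : realType.
Implicit Types (f g : R -> R) (x a b : R).

Lemma derD f g x a b : is_derive x (1:R) f a -> is_derive x (1:R) g b ->
  is_derive x (1:R) (fun y => f y + g y) (a + b).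
Proof. by move=> hf hg; exact: is_deriveD. Qed.

Lemma derB f g x a b : is_derive x (1:R) f a -> is_derive x (1:R) g b ->
  is_derive x (1:R) (fun y => f y - g y) (a - b).
Proof. by move=> hf hg; exact: is_deriveB. Qed.

Lemma derM f g x a b : is_derive x (1:R) f a -> is_derive x (1:R) g b ->
  is_derive x (1:R) (fun y => f y * g y) (a * g x + f x * b).
Proof.
move=> hf hg; apply: is_derive_eq.
by rewrite /GRing.scale/=; ring.
Qed.

Lemma derC (c x : R) : is_derive x (1:R) (fun=> c) 0.
Proof. exact: is_derive_cst. Qed.

Lemma derid x : is_derive x (1:R) (fun y => y) 1.
Proof. exact: is_derive_id. Qed.

Lemma derX f n x a : is_derive x (1:R) f a ->
  is_derive x (1:R) (fun y => f y ^+ n) (n%:R * f x ^+ n.-1 * a).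
Proof.
case: n => [|n] hf; first by rewrite !mul0r; exact: derC.
have -> : (fun y => f y ^+ n.+1) = f ^+ n.+1 by apply/funext => y; rewrite exprfctE.
by apply: is_derive_eq; rewrite /GRing.scale/=; ring.
Qed.

Lemma derV f x a : f x != 0 -> is_derive x (1:R) f a ->
  is_derive x (1:R) (fun y => (f y)^-1) (- a / f x ^+ 2).
Proof.
move=> n0 hf; have h := is_deriveV n0 hf; apply: is_derive_eq.
by rewrite /GRing.scale/= mulNr mulNr mulrC.
Qed.

Lemma derO f g x a b : is_derive (g x) (1:R) f a -> is_derive x (1:R) g b ->
  is_derive x (1:R) (fun y => f (g y)) (a * b).
Proof. by move=> hf hg; exact: is_derive1_comp. Qed.

Lemma der_eq f x a b : is_derive x (1:R) f a -> a = b -> is_derive x (1:R) f b.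
Proof. by move=> + <-. Qed.

Lemma der_unique f x a b : is_derive x (1:R) f a -> is_derive x (1:R) f b -> a = b.
Proof. by move=> [_ <-] [_ <-]. Qed.

Lemma integral_derivative F f a b : a < b ->
  (forall x, a <= x <= b -> is_derive x (1:R) F (f x)) ->
  (forall x, a <= x <= b -> {for x, continuous f}) ->
  (\int[@lebesgue_measure R]_(x in `[a, b]) (f x)%:E = (F b - F a)%:E)%E.
Proof.
move=> ab dF cf.
have cF x : a <= x <= b -> {for x, continuous F} by move=> /dF; exact: is_derive_continuous.
rewrite (@continuous_FTC2 _ _ F) //.
- by apply: continuous_in_subspaceT => x; rewrite inE/= in_itv/=; exact: cf.
- split.
  + by move=> x; rewrite in_itv/= => /andP[? ?]; case: (dF x) => //; apply/andP; split; exact: ltW.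
  + by apply: cvg_at_right_filter; apply: cF; rewrite lexx ltW.
  + by apply: cvg_at_left_filter; apply: cF; rewrite lexx ltW.
- move=> x; rewrite in_itv/= => /andP[? ?].
  by rewrite derive1E; case: (dF x) => //; apply/andP; split; exact: ltW.
Qed.

Lemma Rintegral_derivative F f a b : a < b ->
  (forall x, a <= x <= b -> is_derive x (1:R) F (f x)) ->
  (forall x, a <= x <= b -> {for x, continuous f}) ->
  \int[@lebesgue_measure R]_(x in `[a, b]) f x = F b - F a.
Proof. by move=> *; rewrite /Rintegral (@integral_derivative F). Qed.

End pointwise_derivatives.

Section geom_sumetric_sum.
Variables (R : realType) (a : nat).
Hypothesis a0 : (0 < a)%N.
Implicit Types s : R.

(** The cofactor of 1 - s^2 in 1 - s^(2a). It is at least 1 on the whole line, so the singularity of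
    the integrand of [gF] at 1 sits in the factor 1 - s^2 alone, which the substitution by the sine
    removes. *)
Definition geom_sum s : R := \sum_(i < a) s ^+ (2 * i).

Lemma geom_sumE s : 1 - s ^+ (2 * a) = (1 - s ^+ 2) * geom_sum s.
Proof.
rewrite exprM -[LHS]opprB subrX1 -mulNr opprB; congr (_ * _).
by apply: eq_bigr => i _; rewrite exprM.
Qed.

Lemma geom_sum_ge1 s : 1 <= geom_sum s.
Proof.
rewrite /geom_sum; case: a a0 => // b _.
rewrite big_ord_recl /= muln0 expr0 lerDl sumr_ge0 // => i _.
by rewrite exprM exprn_ge0 // sqr_ge0.
Qed.

Lemma geom_sum_gt0 s : 0 < geom_sum s.
Proof. exact: lt_le_trans ltr01 (geom_sum_ge1 s). Qed.

Lemma geom_sum_le s : s ^+ 2 <= 1 -> geom_sum s <= a%:R.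
Proof.
move=> h; rewrite /geom_sum -[a in a%:R]card_ord -sumr_const; apply: ler_sum => i _.
by rewrite exprM exprn_ile1 // sqr_ge0.
Qed.

Lemma geom_sumN s : geom_sum (- s) = geom_sum s.
Proof. by apply: eq_bigr => i _; rewrite !exprM sqrrN. Qed.

Lemma der_geom_sum s : is_derive s (1:R) geom_sum (\sum_(i < a) (2 * i)%:R * s ^+ (2 * i).-1).
Proof.
rewrite [geom_sum](_ : _ = \sum_(i < a) (fun t : R => t ^+ (2 * i))).
  apply: is_derive_sum => i; apply: der_eq; first exact: derX (derid s).
  by rewrite mulr1.
by apply/funext => t; rewrite fct_sumE.
Qed.

(* Half of the derivative of [geom_sumE] with respect to [s]. *)
Lemma geom_sum_derE s : - s * geom_sum s + (1 - s ^+ 2) * (\sum_(i < a) (2 * i)%:R * s ^+ (2 *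
  i).-1) / 2
  = - a%:R * s ^+ (2 * a).-1.
Proof.
have h1 : is_derive s (1:R) (fun t => (1 - t ^+ 2) * geom_sum t)
    ((0 - 2%:R * s ^+ 1 * 1) * geom_sum s + (1 - s ^+ 2) * (\sum_(i < a) (2 * i)%:R * s ^+ (2 *
      i).-1)).
  apply: derM (der_geom_sum s); apply: derB (derC _ _) _.
  exact: derX (derid s).
have h2 : is_derive s (1:R) (fun t => (1 - t ^+ 2) * geom_sum t) (0 - (2 * a)%:R * s ^+ (2 * a).-1
  * 1).
  rewrite [X in is_derive _ _ X](_ : _ = (fun t => 1 - t ^+ (2 * a))); last first.
    by apply/funext => t; rewrite geom_sumE.
  by apply: derB (derC _ _) _; exact: derX (derid s).
have := der_unique h1 h2; rewrite natrM => e; lra.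
Qed.

End geom_sumetric_sum.

(** * Generalized trigonometric functions *)

(** Monotone convergence along the exhaustion of [0, c[ by the intervals [0, b i]. Continuity is
    asked only to the left of [c], because the integrand of [gF] blows up at 1. *)
Lemma improper_integral (R : realType) (f : R -> R) (b F : R^nat) (c l : R) :
  (forall x, 0 <= x < c -> {for x, continuous f}) -> (forall x, 0 <= f x) ->
  nondecreasing_seq b -> (forall i, b i < c) ->
  (forall x, x < c -> exists i, x <= b i) ->
  (forall i, (\int[@lebesgue_measure R]_(t in `[0%R, b i]) (f t)%:E = (F i)%:E)%E) ->
  F @ \oo --> l ->
  (\int[@lebesgue_measure R]_(t in `[0%R, c]) (f t)%:E = l%:E)%E.
Proof.
move=> cf f0 ndb bc be intf Fl.
have cA (A : set R) : A `<=` [set x | 0 <= x < c] -> {within A, continuous f}.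
  by move=> Ac; apply: continuous_in_subspaceT => x /set_mem /Ac; exact: cf.
have sub0 (d : R) : d < c -> `[0, d] `<=` [set x : R | 0 <= x < c].
  by move=> dc x /=; rewrite in_itv/= => /andP[-> /le_lt_trans]; exact.
have subc : `[0, c[ `<=` [set x : R | 0 <= x < c] by move=> x /=; rewrite in_itv.
have mc : measurable_fun `[(0:R), c[ f.
  by apply: subspace_continuous_measurable_fun => //; exact: cA.
rewrite -integral_itv_bndo_bndc; last exact/measurable_EFinP.
have -> : `[(0:R), c[%classic = \bigcup_i `[(0:R), b i]%classic.
  apply/seteqP; split => [x /=|x [i _ /=]]; rewrite !in_itv/= => /andP[x0 xc].
    by have [i xi] := be x xc; exists i => //=; rewrite in_itv/= x0.
  by rewrite x0 (le_lt_trans xc).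
have nd : nondecreasing_seq (fun i => `[0, b i]%classic : set R).
  apply/nondecreasing_seqP => i; rewrite subsetEset; apply: subset_itvl; rewrite bnd_simp.
  exact: ndb.
have mi i : measurable_fun `[(0:R), b i] f.
  by apply: subspace_continuous_measurable_fun => //; apply: cA; exact: sub0.
have f0' i x : `[(0:R), b i]%classic x -> (0 <= (EFin \o f) x)%E by rewrite /= lee_fin.
have /cvg_lim <- // := @ge0_nondecreasing_set_cvg_integral _ _ R
  (fun i => `[0, b i]%classic : set (measurableTypeR R)) (EFin \o f) (@lebesgue_measure R) nd
  (fun i => measurable_itv _) (fun i => (measurable_EFinP _ _).2 (mi i)) f0'.
apply/cvg_lim => //; under eq_fun do rewrite intf.
by apply: cvg_EFin => //; near=> n.
Unshelve. all: end_near. Qed.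

(* The substitution [t = sin x] turns the singular integrand defining [gF] into the smooth
   positive function [1 / sqrt (1 + sin^2 x + ... + sin^(2 a - 2) x)], whose antiderivative
   [U] is a diffeomorphism of the line; then [gsin a] is [sin] composed with [Th], its inverse. *)
Section amplitude.
Variables (R : realType) (a : nat).
Hypothesis a0 : (0 < a)%N.
Local Notation W x := (Num.sqrt (geom_sum a (sin x))).
Variables (U Th : R -> R).
Hypothesis dU : forall x, is_derive x (1:R) U (W x)^-1.
Hypothesis U0 : U 0 = 0.
Hypothesis UK : cancel U Th.
Hypothesis ThK : cancel Th U.
Hypothesis dTh : forall y, is_derive y (1:R) Th (W (Th y)).

Local Notation sn u := (sin (Th u)).
Local Notation cn u := (cos (Th u) * W (Th u)).

Lemma W_gt0 (x : R) : 0 < W x.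
Proof. by rewrite sqrtr_gt0; apply: geom_sum_gt0. Qed.

Lemma amp_U_lt : {mono U : x y / x < y}.
Proof. by apply: (derive_pos_lt dU) => x; rewrite invr_gt0 W_gt0. Qed.

Lemma amp_Th_lt : {mono Th : x y / x < y}.
Proof. by move=> x y; rewrite -amp_U_lt !ThK. Qed.

Lemma amp_UN x : U (- x) = - U x.
Proof.
apply/esym/eqP; rewrite eqr_oppLR; apply/eqP; move: x.
apply: (antiderivative_unique dU _ (x0 := 0)); last by rewrite oppr0 U0 oppr0.
move=> x; apply: der_eq.
by rewrite sinN geom_sumN mulrN1 opprK.
Qed.

Lemma amp_UDpi x : U (x + pi) = U x + 2 * U (pi / 2).
Proof.
(* At -pi/2 oddness of [U] makes both sides equal to U (pi / 2). *)
move: x; apply: (antiderivative_unique _ _ (x0 := - (pi / 2))).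
- move=> x; apply: der_eq.
  by rewrite addr0 mulr1 sinDpi geom_sumN.
- by move=> x; apply: der_eq; rewrite addr0.
- rewrite amp_UN; have -> : - (pi / 2) + pi = pi / 2 :> R by lra.
  by ring.
Qed.

Lemma amp_Upih_gt0 : 0 < U (pi / 2).
Proof. by rewrite -U0 amp_U_lt divr_gt0 // pi_gt0. Qed.

Lemma der_sn (u : R) : is_derive u (1:R) (fun u => sn u) (cn u).
Proof. exact: derO (is_derive_sin _) (dTh u). Qed.

Lemma cn_sn (u : R) : cn u ^+ 2 + sn u ^+ (2 * a) = 1.
Proof.
rewrite exprMn sqr_sqrtr; last by rewrite ltW // geom_sum_gt0.
by rewrite cos2sin2 -geom_sumE // subrK.
Qed.

Lemma der_cn (u : R) : is_derive u (1:R) (fun u => cn u) (- a%:R * sn u ^+ (2 * a).-1).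
Proof.
have h1 := derO (g := fun x => geom_sum a (sin x)) (is_derive1_sqrt (geom_sum_gt0 a0 (sin (Th
  u)))) (derO (der_geom_sum a (sin (Th u))) (is_derive_sin (Th u))).
apply: (der_eq (derM (derO (is_derive_cos (Th u)) (dTh u)) (derO (f := fun x =>
  Num.sqrt (geom_sum a (sin x))) h1 (dTh u)))).
rewrite -geom_sum_derE -cos2sin2.
set S := \sum_(i < a) _; set w := Num.sqrt _; set c := cos _; set s := sin _.
have w0 : w != 0 by rewrite gt_eqF // W_gt0.
have -> : geom_sum a s = w ^+ 2 by rewrite sqr_sqrtr // ltW // geom_sum_gt0.
by field.
Qed.

Lemma sn_N u : sn (- u) = - sn u.
Proof. by rewrite -{1}(ThK u) -amp_UN UK sinN. Qed.

Lemma Th_D u : Th (u + 2 * U (pi / 2)) = Th u + pi.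
Proof. by rewrite -{1}(ThK u) -amp_UDpi UK. Qed.

Lemma sn_D u : sn (u + 2 * U (pi / 2)) = - sn u.
Proof. by rewrite Th_D sinDpi. Qed.

Lemma sn_Dn (n : nat) u : sn (u + 2 * (2 * U (pi / 2)) * n%:R) = sn u.
Proof.
elim: n u => [|n ih] u; first by rewrite mulr0 addr0.
rewrite -[RHS]ih -[RHS]opprK -sn_D -sn_D; congr (sin (Th _)).
by rewrite -natr1; ring.
Qed.

Lemma sn_Dz (z : int) u : sn (u - 2 * (2 * U (pi / 2)) * z%:~R) = sn u.
Proof.
case: z => n.
  by rewrite -[LHS](sn_Dn n) subrK.
rewrite -[RHS](sn_Dn n.+1); congr (sin (Th _)).
by rewrite NegzE mulrNz mulrN opprK.
Qed.

Let integrand (t : R) : R := (Num.sqrt (1 - t ^+ (2 * a)))^-1.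

Lemma exp2a_lt1 (t : R) : 0 <= t < 1 -> t ^+ (2 * a) < 1.
Proof. by case/andP => t0 t1; rewrite exprn_ilt1 // muln_eq0 /= -lt0n. Qed.

Lemma integrand_derivative (t : R) : 0 <= t < 1 -> is_derive t (1:R) (U \o asin) (integrand t).
Proof.
move=> /[dup] t01 /andP[t0 t1].
have tI : -1 < t < 1 by apply/andP; split; lra.
have tI' : t \in `[(-1), 1] by rewrite in_itv/=; apply/andP; split; lra.
apply: (der_eq (derO (dU _) (is_derive1_asin tI))).
have h1 : 0 <= 1 - t ^+ 2 by rewrite subr_ge0 exprn_ile1 // ltW.
by rewrite (asinK tI') /integrand geom_sumE (sqrtrM _ h1) invfM mulrC.
Qed.

Lemma integrand_continuous (t : R) : 0 <= t < 1 -> {for t, continuous integrand}.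
Proof.
move=> t01; apply: continuousV.
  by rewrite gt_eqF // sqrtr_gt0 subr_gt0 exp2a_lt1.
apply: continuous_comp; last exact: sqrt_continuous.
exact: (is_derive_continuous (derB (derC 1 t) (derX (2 * a) (derid t)))).
Qed.

Lemma asin0 : asin (0 : R) = 0.
Proof.
rewrite -[in LHS](@sin0 R) sinK // in_itv/=.
by have := pi_gt0 R => p; apply/andP; split; lra.
Qed.

Lemma gF_integral (s : R) : 0 <= s < 1 ->
  (\int[@lebesgue_measure R]_(t in `[0%R, s]) (integrand t)%:E = (U (asin s))%:E)%E.
Proof.
case/andP; rewrite le_eqVlt => /orP[/eqP<- _|s0 s1].
  by rewrite set_itv1 integral_set1 asin0 U0.
have -> : U (asin s) = (U \o asin) s - (U \o asin) 0 by rewrite /= asin0 U0 subr0.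
apply: (@integral_derivative R (U \o asin) integrand) => //.
- by move=> x /andP[? ?]; apply: integrand_derivative; apply/andP; split; lra.
- by move=> x /andP[? ?]; apply: integrand_continuous; apply/andP; split; lra.
Qed.

Lemma asin1 : asin (1 : R) = pi / 2.
Proof.
have p := pi_gt0 R.
by rewrite -[in LHS](@sin_pihalf R) sinK // in_itv/=; apply/andP; split; lra.
Qed.

Lemma gF_integral1 :
  (\int[@lebesgue_measure R]_(t in `[0%R, 1%R]) (integrand t)%:E = (U (pi / 2))%:E)%E.
Proof.
(* These angles start at 0 and increase to pi/2. Cutting the integral at sin (tt i) gives exactly U
   (tt i), whose limit is known by continuity. *)
pose tt (i : nat) : R := pi / 2 - (pi / 2) / i.+1%:R.
have p0 := pi_gt0 R.
have tt0 i : 0 <= tt i.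
  rewrite /tt subr_ge0 ler_pdivrMr ?ltr0n // ler_peMr ?ler1n //; lra.
have tt1 i : tt i < pi / 2 by rewrite /tt ltrBlDr ltrDl divr_gt0 // divr_gt0.
have tt_le i j : (i <= j)%N -> tt i <= tt j.
  move=> ij; rewrite /tt lerB // ler_pM2l ?divr_gt0 //.
  by rewrite lef_pV2 ?posrE ?ltr0n // ler_nat.
have in_pih (x : R) : 0 <= x -> x <= pi / 2 -> x \in `[(- (pi / 2)), pi / 2].
  by move=> *; rewrite in_itv/=; apply/andP; split; lra.
have sin_le (x y : R) : 0 <= x -> x <= y -> y <= pi / 2 -> sin x <= sin y.
  move=> hx hxy hy; rewrite leNgt ltr_sin -?leNgt //; apply: in_pih => //; lra.
have sinI i : 0 <= sin (tt i) < 1.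
  rewrite sin_ge0_pi; last by have := tt1 i; have := tt0 i => *; apply/andP; split; lra.
  rewrite /= -[ltRHS](@sin_pihalf R) ltr_sin //; apply: in_pih => //; first exact: ltW.
  by rewrite divr_ge0 // ltW.
apply: (@improper_integral R integrand (fun i => sin (tt i)) (fun i => U (tt i))).
- exact: integrand_continuous.
- by move=> x; rewrite invr_ge0 sqrtr_ge0.
- by move=> i j ij; apply: sin_le; [exact: tt0|exact: tt_le|exact: ltW].
- by move=> i; case/andP: (sinI i).
- move=> x x1; have [x0|x0] := ltP x 0.
    by exists 0%N; apply: le_trans (ltW x0) _; case/andP: (sinI 0%N).
  have xI : x \in `[(-1), 1] by rewrite in_itv/=; apply/andP; split; lra.
  have ax : asin x < pi / 2 by apply: asin_ltpi2; apply/andP; split; lra.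
  have [i hi] := ltr_add_invr ax.
  (* With this [k] the defect (pi/2) / (k+1) of [tt k] is at most 1 / (i+1), the gap left between
     asin x and pi/2. *)
  pose k := Num.truncn ((pi / 2) * i.+1%:R : R).
  exists k; rewrite -(asinK xI).
  have le1 : asin x <= tt k.
    rewrite /tt lerBrDr; apply: le_trans (ltW hi); rewrite lerD2l.
    rewrite ler_pdivrMr ?ltr0n // ler_pdivlMl ?ltr0n // mulrC.
    by apply: ltW; exact: truncnS_gt.
  have ain : asin x \in `[(- (pi / 2)), pi / 2].
    by rewrite in_itv/=; apply/andP; split; [apply: asin_geNpi2; apply/andP; split; lra|exact: ltW].
  have tin : tt k \in `[(- (pi / 2)), pi / 2] by apply: in_pih => //; exact: ltW.
  by rewrite leNgt ltr_sin // -leNgt.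
- move=> i; rewrite gF_integral // sinK //; apply: in_pih => //; exact: ltW.
- apply: continuous_cvg; first exact: is_derive_continuous (dU _).
  rewrite /tt -[X in _ --> X]subr0; apply: cvgB; first exact: cvg_cst.
  rewrite -[X in _ --> X](mulr0 (pi / 2)); apply: cvgM; first exact: cvg_cst.
  exact: cvg_harmonic.
Qed.

Lemma gF_asin (s : R) : 0 <= s <= 1 -> gF a s = U (asin s).
Proof.
case/andP => s0; rewrite le_eqVlt => /orP[/eqP->|s1]; rewrite /gF /Rintegral.
  by rewrite gF_integral1 asin1.
by rewrite gF_integral // s0.
Qed.

Lemma gpiE : gpi R a = 2 * U (pi / 2).
Proof. by rewrite /gpi gF_asin ?ler01 ?lexx // asin1. Qed.

Lemma Th_pih (u : R) : 0 <= u <= U (pi / 2) -> 0 <= Th u <= pi / 2.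
Proof.
have Ule (x y : R) : (x <= y) = (U x <= U y) by rewrite !leNgt amp_U_lt.
by move=> h; rewrite (Ule 0) (Ule (Th u)) ThK U0.
Qed.

Lemma gsin_baseE (u : R) : 0 <= u <= U (pi / 2) -> gsin_base a u = sn u.
Proof.
move=> /Th_pih hT; have p0 := pi_gt0 R.
apply: xget_unique => [|s [s01 <-]].
  have s01 : 0 <= sn u <= 1.
    by rewrite sin_le1 andbT; apply: sin_ge0_pi; case/andP: hT => *; apply/andP; split; lra.
  split => //; rewrite gF_asin // sinK ?ThK // in_itv/=.
  by case/andP: hT => *; apply/andP; split; lra.
rewrite gF_asin // UK asinK // in_itv/=.
by case/andP: s01 => *; apply/andP; split; lra.
Qed.

Lemma gsinE : gsin a = (fun u => sn u) :> (R -> R).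
Proof.
apply/funext => u; rewrite /gsin gpiE.
have p0 := amp_Upih_gt0; set P := U (pi / 2) in p0 *.
set k := Num.floor _; set v := u - _.
have P20 : 0 < 2 * (2 * P) by rewrite !mulr_gt0.
have /andP[k1 k2] := floor_itv ((u + 2 * P) / (2 * (2 * P))).
rewrite -/k in k1 k2; rewrite ler_pdivlMr // in k1; rewrite ltr_pdivrMr // in k2.
rewrite intrD in k2.
have v1 : - (2 * P) <= v by rewrite /v; lra.
have v2 : v < 2 * P by rewrite /v; lra.
have -> : sn u = sn v by rewrite /v sn_Dz.
have w1 : `|v| <= 2 * P by rewrite ler_norml v1 ltW.
have -> : gsin_base a (if `|v| <= 2 * P / 2 then `|v| else 2 * P - `|v|) = sn `|v|.
  case: ifPn => [w2|]; first by rewrite gsin_baseE // normr_ge0 /=; move: w2;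
    rewrite mulrAC divff // mul1r.
  rewrite -ltNge => w2; rewrite gsin_baseE; last by rewrite -/P; apply/andP; split; lra.
  by rewrite -[LHS]opprK -sn_N opprB -sn_D subrK.
case: ltP => v0; first by rewrite ltr0_norm // sn_N mulN1r opprK.
by rewrite ger0_norm // mul1r.
Qed.

Lemma gcosE : gcos a = (fun u => cn u) :> (R -> R).
Proof.
apply/funext => u; rewrite /gcos gsinE derive1E.
by have [_ ->] := der_sn u.
Qed.

End amplitude.

Section generalized_trigonometry.
Variables (R : realType) (a : nat).
Hypothesis a0 : (0 < a)%N.

Lemma amplitude_exists : exists U Th : R -> R,
  [/\ forall x, is_derive x (1:R) U (Num.sqrt (geom_sum a (sin x)))^-1, U 0 =
    0, cancel U Th, cancel Th U
   & forall y, is_derive y (1:R) Th (Num.sqrt (geom_sum a (sin (Th y))))].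
Proof.
have W0 (x : R) : 0 < Num.sqrt (geom_sum a (sin x)) by rewrite sqrtr_gt0 geom_sum_gt0.
have cW : continuous (fun x : R => (Num.sqrt (geom_sum a (sin x)))^-1).
  move=> /= x; have n0 : Num.sqrt (geom_sum a (sin x)) != 0 by rewrite gt_eqF.
  have h := derO (g := fun x => geom_sum a (sin x)) (is_derive1_sqrt (geom_sum_gt0 a0 (sin x)))
    (derO (der_geom_sum a (sin x)) (is_derive_sin x)).
  have h2 : is_derive (x : R) (1:R) (fun y : R =>
    (Num.sqrt (geom_sum a (sin y)))^-1) _ := derV (f := fun y : R =>
      Num.sqrt (geom_sum a (sin y))) n0 h.
  exact: is_derive_continuous h2.
have [U [dU U0]] := antiderivative_exists cW.
(* At values of the sine [geom_sum] is at most [a]. The resulting uniform lower bound on the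
   derivative of [U] is what makes [U] onto. *)
have m0 : 0 < (Num.sqrt a%:R)^-1 :> R by rewrite invr_gt0 sqrtr_gt0 ltr0n.
have mW (x : R) : (Num.sqrt a%:R)^-1 <= (Num.sqrt (geom_sum a (sin x)))^-1.
  rewrite lef_pV2 ?posrE ?sqrtr_gt0 ?ltr0n ?geom_sum_gt0 // ler_sqrt ?ltr0n //.
  apply: geom_sum_le; rewrite sin2cos2; have := sqr_ge0 (cos x) => *; lra.
have [Th [UK ThK dTh]] := inverse_exists m0 dU mW.
by exists U, Th; split => // y; apply: (der_eq (dTh y)); rewrite invrK.
Qed.

Local Notation s := (@gsin R a).
Local Notation c := (@gcos R a).
Local Notation p := (gpi R a).

Lemma gpi_gt0 : 0 < p.
Proof.
have [U [Th [dU U0 UK ThK dTh]]] := amplitude_exists.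
by rewrite (gpiE a0 dU U0) mulr_gt0 // (amp_Upih_gt0 a0 dU U0).
Qed.

Lemma der_gsin (u : R) : is_derive u (1:R) s (c u).
Proof.
have [U [Th [dU U0 UK ThK dTh]]] := amplitude_exists.
rewrite (gcosE a0 dU U0 UK ThK dTh) (gsinE a0 dU U0 UK ThK).
exact: der_sn dTh u.
Qed.

Lemma der_gcos (u : R) : is_derive u (1:R) c (- a%:R * s u ^+ (2 * a).-1).
Proof.
have [U [Th [dU U0 UK ThK dTh]]] := amplitude_exists.
rewrite (gcosE a0 dU U0 UK ThK dTh) (gsinE a0 dU U0 UK ThK).
exact (der_cn a0 dTh u).
Qed.

Lemma gcos_gsin (u : R) : c u ^+ 2 + s u ^+ (2 * a) = 1.
Proof.
have [U [Th [dU U0 UK ThK dTh]]] := amplitude_exists.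
rewrite (gcosE a0 dU U0 UK ThK dTh) (gsinE a0 dU U0 UK ThK).
exact: cn_sn a0 Th u.
Qed.

Lemma gsinDpi (u : R) : s (u + p) = - s u.
Proof.
have [U [Th [dU U0 UK ThK dTh]]] := amplitude_exists.
rewrite (gsinE a0 dU U0 UK ThK) (gpiE a0 dU U0).
exact: sn_D.
Qed.

Lemma gcosDpi (u : R) : c (u + p) = - c u.
Proof.
have [U [Th [dU U0 UK ThK dTh]]] := amplitude_exists.
rewrite (gcosE a0 dU U0 UK ThK dTh) (gpiE a0 dU U0).
by rewrite (Th_D dU U0 UK ThK) cosDpi sinDpi geom_sumN mulNr.
Qed.

Lemma gsinN (u : R) : s (- u) = - s u.
Proof.
have [U [Th [dU U0 UK ThK dTh]]] := amplitude_exists.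
rewrite (gsinE a0 dU U0 UK ThK).
exact: sn_N.
Qed.

Lemma gcosN (u : R) : c (- u) = c u.
Proof.
have [U [Th [dU U0 UK ThK dTh]]] := amplitude_exists.
rewrite (gcosE a0 dU U0 UK ThK dTh).
have -> : Th (- u) = - Th u by rewrite -{1}(ThK u) -(amp_UN dU U0) UK.
by rewrite cosN sinN geom_sumN.
Qed.

Lemma gsin_gt0 (u : R) : 0 < u < p -> 0 < s u.
Proof.
have [U [Th [dU U0 UK ThK dTh]]] := amplitude_exists.
rewrite (gsinE a0 dU U0 UK ThK) => /andP[u0 up]; apply: sin_gt0_pi.
have lt := amp_Th_lt a0 dU ThK.
rewrite -[X in X < Th _](UK 0) U0 lt u0 /= -[X in _ < X]add0r -[X in X + _](UK 0) U0.
by rewrite -(Th_D dU U0 UK ThK) lt add0r -(gpiE a0 dU U0).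
Qed.

Lemma gcos_gt0 (u : R) : - (p / 2) < u < p / 2 -> 0 < c u.
Proof.
have [U [Th [dU U0 UK ThK dTh]]] := amplitude_exists.
rewrite (gcosE a0 dU U0 UK ThK dTh) (gpiE a0 dU U0) mulrAC divff // mul1r => /andP[u1 u2].
have lt := amp_Th_lt a0 dU ThK.
rewrite mulr_gt0 ?sqrtr_gt0 ?geom_sum_gt0 //; apply: cos_gt0_pihalf.
by apply/andP; split; [rewrite -(UK (- (pi / 2))) lt (amp_UN dU U0)|rewrite -(UK (pi / 2)) lt].
Qed.

Lemma gcos_pih : c (p / 2) = 0.
Proof.
have [U [Th [dU U0 UK ThK dTh]]] := amplitude_exists.
rewrite (gcosE a0 dU U0 UK ThK dTh) (gpiE a0 dU U0) mulrAC divff // mul1r UK.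
by rewrite cos_pihalf mul0r.
Qed.

End generalized_trigonometry.

(** * The conjugate equation *)

Lemma mean_value_on (R : realType) (f df : R -> R) (a b : R) : a < b ->
  (forall x, a <= x <= b -> is_derive x (1:R) f (df x)) ->
  exists2 c, a < c < b & f b - f a = df c * (b - a).
Proof.
move=> ab h; have [] := @MVT R f df a b ab.
- move=> x; rewrite in_itv/= => /andP[/ltW ? /ltW ?]; apply: h; exact/andP.
- apply: continuous_in_subspaceT => x; rewrite inE/= in_itv/= => /h.
  exact: is_derive_continuous.
- by move=> c; rewrite in_itv/= => ? ?; exists c.
Qed.

Section conjugate_equation.
Variables (R : realType) (a : nat).
Hypothesis a0 : (0 < a)%N.
Local Notation s := (@gsin R a).
Local Notation c := (@gcos R a).
Local Notation p := (gpi R a).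
Implicit Types u x y phi : R.

Lemma gsin0 : s 0 = 0.
Proof. by have := gsinN a0 (0:R); rewrite oppr0 => h; lra. Qed.

Lemma gcos0 : c 0 = 1.
Proof.
have p0 := gpi_gt0 R a0.
have h : 0 < c 0 by apply: (gcos_gt0 a0); apply/andP; split; lra.
have := gcos_gsin a0 (0:R); rewrite gsin0 expr0n muln_eq0 /= eqn0Ngt a0 addr0.
by move/eqP; rewrite sqrf_eq1 => /orP[/eqP//|/eqP e]; move: h; rewrite e; lra.
Qed.

Lemma gsin_eq0_gcos u : c u = 0 -> s u != 0.
Proof.
move=> c0; apply/eqP => s0; have := gcos_gsin a0 u.
by rewrite c0 s0 !expr0n muln_eq0 /= eqn0Ngt a0 addr0 => /eqP; rewrite eq_sym oner_eq0.
Qed.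

Lemma gsinXodd u : s u * s u ^+ (2 * a).-1 = s u ^+ (2 * a).
Proof. by rewrite -exprS prednK // muln_gt0. Qed.

Lemma gcos_decr x y : 0 <= x -> x < y -> y <= p -> c y < c x.
Proof.
have p0 := gpi_gt0 R a0.
move=> x0 xy yp.
have [z /andP[z1 z2]] := mean_value_on xy (fun x _ => der_gcos a0 x).
move=> e; rewrite -subr_lt0 e pmulr_llt0 ?subr_gt0 // mulNr oppr_lt0.
rewrite mulr_gt0 ?ltr0n // exprn_gt0 // (gsin_gt0 a0) //.
by apply/andP; split; lra.
Qed.

Lemma gcos_eq0 u : 0 <= u < 2 * p -> c u = 0 -> u = p / 2 \/ u = 3 * p / 2.
Proof.
have p0 := gpi_gt0 R a0.
move=> /andP[u0 u2] cu.
have [h|h|->] := ltgtP u (p / 2); last by left.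
  have : 0 < c u by apply: (gcos_gt0 a0); apply/andP; split; lra.
  by rewrite cu ltxx.
have [h1|h1|e] := ltgtP (u - p) (p / 2); last by right; lra.
- have : 0 < c (u - p) by apply: (gcos_gt0 a0); apply/andP; split; lra.
  by have := gcosDpi a0 (u - p); rewrite subrK cu => *; lra.
- have : 0 < c (u - p - p) by apply: (gcos_gt0 a0); apply/andP; split; lra.
  have := gcosDpi a0 (u - p); have := gcosDpi a0 (u - p - p).
  by rewrite !subrK cu => *; lra.
Qed.

Lemma gcos_zero u : u = p / 2 \/ u = 3 * p / 2 -> c u = 0.
Proof.
case=> ->; first exact: gcos_pih.
have -> : 3 * p / 2 = p / 2 + p by lra.
by rewrite gcosDpi // gcos_pih // oppr0.
Qed.

(** cos_a decreases strictly from 1 to -1 on [0, pi_a]. Its derivative vanishes at both ends, so the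
    inverse is considered on the open interval only. *)
Lemma gacos_exists : exists A : R -> R, forall z, -1 < z < 1 ->
  [/\ 0 < A z < p, c (A z) = z & is_derive z (1:R) A (- a%:R * s (A z) ^+ (2 * a).-1)^-1].
Proof.
have p0 := gpi_gt0 R a0.
have cpi : c p = -1 by rewrite -(add0r p) gcosDpi // gcos0.
have ex (z : R) : exists u, -1 < z < 1 -> 0 < u < p /\ c u = z.
  have [/andP[z1 z2]|h] := boolP (-1 < z < 1); last by exists 0.
  have cw : {within `[0, p], continuous c} by apply: is_derive_within; exact: der_gcos.
  have := @IVT R c 0 p z (ltW p0) cw; rewrite gcos0 cpi.
  case; first by rewrite ge_min le_max; apply/andP; split; apply/orP; [right|left]; exact: ltW.
  move=> u; rewrite in_itv/= => /andP[u0 u1] cu; exists u => _; split => //.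
  rewrite !lt_neqAle u0 u1 !andbT; apply/andP; split; apply/eqP => e.
    by move: cu z2; rewrite -e gcos0 => <-; rewrite ltxx.
  by move: cu z1; rewrite e cpi => <-; rewrite ltxx.
have [A hA] := choice ex.
exists A => z zI; have [Az cA] := hA z zI; split => //.
rewrite -[in is_derive z](cA).
have near_in : \forall x \near A z, 0 < x < p.
  have AzI : A z \in `]0, p[ by rewrite in_itv.
  by apply: filterS (near_in_itvoo AzI) => x; rewrite in_itv.
apply: is_derive_inverse.
- near=> x.
  have /andP[x0 xp] : 0 < x < p by near: x.
  have cI : -1 < c x < 1.
    by rewrite -cpi -gcos0 !gcos_decr // ltW.
  have [/andP[A0 Ap] e] := hA _ cI.
  have [h|h|//] := ltgtP (A (c x)) x.
    by have := gcos_decr (ltW A0) h (ltW xp); rewrite e ltxx.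
  by have := gcos_decr (ltW x0) h (ltW Ap); rewrite e ltxx.
- by near=> x; apply: is_derive_continuous (der_gcos a0 x).
- exact: der_gcos.
- rewrite mulf_neq0 // ?oppr_eq0 ?pnatr_eq0 -?lt0n // expf_neq0 // gt_eqF //.
  exact: gsin_gt0.
Unshelve. all: end_near. Qed.

(* [conj_fun phi u = 0] is the equation [tan psi - psi = tan phi - phi], [psi = phi + u],
   cleared of denominators. *)
Definition conj_fun phi u : R := c (phi + u) * (u * c phi + s phi) - s (phi + u) * c phi.

Lemma conj_funDpi phi u : conj_fun (phi + p) u = conj_fun phi u.
Proof. by rewrite /conj_fun addrAC !(gsinDpi a0) !(gcosDpi a0); ring. Qed.

Lemma conj_fun_pi phi : c phi = 0 -> conj_fun phi p = 0.
Proof. by move=> h; rewrite /conj_fun (gcosDpi a0) h; ring. Qed.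

Let T x : R := s x / c x - x.

Lemma der_T x : c x != 0 -> is_derive x (1:R) T (a%:R * s x ^+ (2 * a) / c x ^+ 2).
Proof.
move=> cx; apply: (der_eq (derB (derM (der_gsin a0 x) (derV cx (der_gcos a0 x))) (derid x))).
rewrite -(gsinXodd x); have h := gcos_gsin a0 x; rewrite -gsinXodd in h.
by field.
Qed.

Lemma T_incr x y : - (p / 2) < x -> x < y -> y < p / 2 -> T x < T y.
Proof.
have p0 := gpi_gt0 R a0.
move=> xp xy yp.
(* The derivative of [T] vanishes at 0, so strictness is first obtained on intervals that do not
   have 0 in their interior, and the two sides are then joined at 0. *)
have key (x' y' : R) : x <= x' -> x' < y' -> y' <= y -> (y' <= 0) || (0 <= x') -> T x' < T y'.
  move=> hx hxy hy h0.
  have cn z : x' <= z <= y' -> 0 < c z.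
    by move=> /andP[? ?]; apply: (gcos_gt0 a0); apply/andP; split; lra.
  have [z /andP[z1 z2] e] := mean_value_on hxy (fun z hz => der_T (lt0r_neq0 (cn z hz))).
  rewrite -subr_gt0 e mulr_gt0 ?subr_gt0 // divr_gt0 //; last first.
    by rewrite exprn_gt0 // cn // !ltW.
  rewrite mulr_gt0 ?ltr0n // exprM exprn_gt0 // exprn_even_gt0 //=.
  case/orP: h0 => h0.
    rewrite -oppr_eq0 -(gsinN a0) gt_eqF // (gsin_gt0 a0) //.
    by apply/andP; split; lra.
  by rewrite gt_eqF // (gsin_gt0 a0) //; apply/andP; split; lra.
have [y0|y0] := leP y 0; first by apply: key => //; rewrite y0.
have [x0|x0] := leP 0 x; first by apply: key => //; rewrite x0 orbT.
apply: (@lt_trans _ _ (T 0)).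
  by apply: key => //; [exact: ltW|rewrite lexx].
by apply: key => //; [exact: ltW|rewrite lexx orbT].
Qed.

(** The two poles need separate care. If phi is the pole pi_a/2, then [conj_fun] reduces to cos_a
    (phi + u) sin_a phi, which does not vanish before u = pi_a. If phi is no pole, phi + u cannot be
    one either, since then [conj_fun] would be - sin_a (phi + u) cos_a phi. Away from the poles, [T]
    takes at phi + u either a larger value than at phi (same branch) or a value smaller by at least
    pi_a (next branch), so no zero exists. *)
Lemma conj_fun_eq0_half phi u : - (p / 2) < phi <= p / 2 -> 0 < u <= p ->
  conj_fun phi u = 0 -> u = p /\ c phi = 0.
Proof.
have p0 := gpi_gt0 R a0.
move=> /andP[f1 f2] /andP[u0 u1] K.
have [e|nphi] := eqVneq phi (p / 2).
  have cphi : c phi = 0 by rewrite e gcos_pih.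
  split => //; apply/eqP; rewrite eq_le u1 leNgt; apply/negP => up.
  have /eqP := K; rewrite /conj_fun cphi !mulr0 add0r subr0 mulf_eq0 (negbTE (gsin_eq0_gcos cphi))
    orbF.
  have : 0 < c (phi + u - p) by apply: (gcos_gt0 a0); apply/andP; split; lra.
  have := gcosDpi a0 (phi + u - p); rewrite subrK => -> h; rewrite oppr_eq0.
  by rewrite gt_eqF.
have f3 : phi < p / 2 by rewrite lt_neqAle nphi.
have cphi : 0 < c phi by apply: (gcos_gt0 a0); apply/andP.
exfalso.
have cpsi : c (phi + u) != 0.
  apply/eqP => h; have := K; rewrite /conj_fun h mul0r sub0r => /eqP.
  by rewrite oppr_eq0 mulf_eq0 (negbTE (gsin_eq0_gcos h)) gt_eqF.
have TT : T (phi + u) = T phi.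
  have : conj_fun phi u / (c (phi + u) * c phi) = 0 by rewrite K mul0r.
  have cphi' : c phi != 0 by rewrite gt_eqF.
  rewrite /T => h; apply/eqP; rewrite -subr_eq0 -oppr_eq0 -[X in _ == X]h; apply/eqP.
  rewrite /conj_fun; by field; apply/andP.
have [h|h|h] := ltgtP (phi + u) (p / 2).
- by have := @T_incr phi (phi + u) f1 _ h; rewrite TT ltxx ltrDl => /(_ u0).
- have TD : T (phi + u) = T (phi + u - p) - p.
    rewrite /T -{1 2}(subrK p (phi + u)) (gsinDpi a0) (gcosDpi a0) invrN mulrNN; ring.
  have [e|ne] := eqVneq (phi + u - p) phi.
    by move: TT; rewrite TD e; lra.
  have : T (phi + u - p) < T phi.
    by apply: T_incr => //; [lra|rewrite lt_neqAle ne /=; lra].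
  by move: TT; rewrite TD; lra.
- by move: cpsi; rewrite h gcos_pih ?eqxx.
Qed.

(** Shifting phi by pi_a changes neither [conj_fun] nor the vanishing of cos_a phi, which brings
    every phi in the range of [phase] into the branch ]-pi_a/2, pi_a/2]. *)
Lemma conj_fun_eq0 phi u : - p < phi < p -> 0 < u ->
  conj_fun phi u = 0 -> p <= u /\ (u = p -> c phi = 0).
Proof.
have p0 := gpi_gt0 R a0.
move=> /andP[f1 f2] u0 K.
have [up|up] := leP u p; last first.
  by split; [exact: ltW|move=> e; move: up; rewrite e ltxx].
have uI : 0 < u <= p by apply/andP.
have [h1|h1] := leP phi (- (p / 2)).
  have [] := @conj_fun_eq0_half (phi + p) u _ uI; first by apply/andP; split; lra.
    by rewrite conj_funDpi.
  by move=> -> /eqP; rewrite gcosDpi // oppr_eq0 => /eqP ->.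
have [h2|h2] := leP phi (p / 2).
  have [] := @conj_fun_eq0_half phi u _ uI K; first by apply/andP.
  by move=> -> ->.
have [] := @conj_fun_eq0_half (phi - p) u _ uI; first by apply/andP; split; lra.
  by rewrite -conj_funDpi subrK.
by move=> -> h; split => // _; rewrite -(subrK p phi) gcosDpi // h oppr0.
Qed.

End conjugate_equation.

(** * One degree of freedom *)

(** Made total in [a], so that the formulas of a level carry no positivity proof; the value [id] at
    exponent 0 is a default. *)
Definition gacos (R : realType) (a : nat) : R -> R :=
  if pselect (0 < a)%N is left a0 then sval (cid (gacos_exists R a0)) else id.

Lemma gacosP (R : realType) (a : nat) (z : R) : (0 < a)%N -> -1 < z < 1 ->
  [/\ 0 < gacos a z < gpi R a, gcos a (gacos a z) = z &
      is_derive z (1:R) (gacos a) (- a%:R * gsin a (gacos a z) ^+ (2 * a).-1)^-1].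
Proof.
by rewrite /gacos; case: pselect => // a0 _ zI; case: cid => A /= /(_ z zI).
Qed.

Section one_degree.
Variables (R : realType) (a : nat) (x0 : R).
Local Notation sn := (@gsin R a).
Local Notation cs := (@gcos R a).
Implicit Types s p E t : R.

Definition level_energy p E : R := p ^+ 2 + x0 ^+ (2 * a) * E.
Definition speed p E : R := Num.sqrt (level_energy p E).
(** The sign of [x0] gives sin_a of the phase the same sign, so that the amplitude A = x0 / sin_a
    phase is positive. The frequency is speed / A, as x' = p demands. *)
Definition phase p E : R := Num.sg x0 * gacos a (p / speed p E).
Definition freq p E : R := speed p E * sn (phase p E) / x0.
Definition angle s p E : R := freq p E * s + phase p E.
(* For [a > 0] the orbit is [A sin_a (omega s + phase)] with [A = x0 / sin_a phase]. *)
Definition orbit_x s p E : R :=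
  if a == 0%N then x0 + p * s else x0 * sn (angle s p E) / sn (phase p E).
Definition orbit_p s p E : R := if a == 0%N then p else speed p E * cs (angle s p E).
(* By the virial identity [(x p)' = p^2 - a x^(2 a) E] this is the integral of [x^(2 a)]. *)
Definition orbit_clock s p E : R :=
  (level_energy p E * s - (orbit_x s p E * orbit_p s p E - x0 * p)) / ((1 + a)%:R * E).
(* The ratio [dx / dp] of a variation that fixes the energy of the level and its clock. *)
Definition conj_coef s p E : R :=
  if a == 0%N then s
  else - x0 * conj_fun a (phase p E) (freq p E * s)
       / (a%:R * speed p E * sn (phase p E) ^+ (2 * a).+1).

Hypothesis x0n : a != 0%N -> x0 != 0.

(** Multiplying a covector by t multiplies the energies by t^2, leaves the phase alone and speeds up
    the motion by t. These laws later turn the time-one map at [t *: p0] into the flow of [p0] at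
    time t. *)
Lemma speed_scale t p E : 0 < t -> speed (t * p) (t ^+ 2 * E) = t * speed p E.
Proof.
move=> t0; rewrite /speed /level_energy.
have -> : (t * p) ^+ 2 + x0 ^+ (2 * a) * (t ^+ 2 * E) =
  t ^+ 2 * level_energy p E by rewrite /level_energy; ring.
by rewrite sqrtrM ?sqr_ge0 // sqrtr_sqr ger0_norm // ltW.
Qed.

Lemma level_energy_scale t p E : level_energy (t * p) (t ^+ 2 * E) = t ^+ 2 * level_energy p E.
Proof. by rewrite /level_energy; ring. Qed.

Section a_pos.
Hypothesis a0 : (0 < a)%N.

Lemma x0_neq0 : x0 != 0.
Proof. by apply: x0n; rewrite -lt0n. Qed.

Lemma x0X_gt0 : 0 < x0 ^+ (2 * a).
Proof. by rewrite exprM exprn_gt0 // exprn_even_gt0 //= x0_neq0. Qed.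

Variables p E : R.
Hypothesis E0 : 0 < E.

Lemma level_energy_gt0 : 0 < level_energy p E.
Proof. by rewrite /level_energy ltr_wpDl ?sqr_ge0 // mulr_gt0 // x0X_gt0. Qed.

Lemma speed_gt0 : 0 < speed p E.
Proof. by rewrite sqrtr_gt0 level_energy_gt0. Qed.

Lemma speedK : speed p E ^+ 2 = level_energy p E.
Proof. by rewrite sqr_sqrtr // ltW // level_energy_gt0. Qed.

(** Strictness comes from x0^(2a) E > 0; it keeps [gacos] inside the interval where it is
    differentiable. *)
Lemma ratio_itv : -1 < p / speed p E < 1.
Proof.
have v0 := speed_gt0; have h : p ^+ 2 < speed p E ^+ 2.
  by rewrite speedK /level_energy ltrDl mulr_gt0 // x0X_gt0.
have : `|p| < speed p E by rewrite -(ger0_norm (ltW v0)) -ltr_sqr ?nnegrE // !real_normK ?num_real.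
rewrite ltr_norml => /andP[h1 h2].
by rewrite ltr_pdivlMr // ltr_pdivrMr // mul1r mulN1r h1.
Qed.

Lemma sg_x0 : Num.sg x0 ^+ 2 = 1.
Proof. by rewrite sqr_sg x0_neq0. Qed.

Lemma sg_x0_case : Num.sg x0 = 1 /\ 0 < x0 \/ Num.sg x0 = -1 /\ x0 < 0.
Proof. by case: sgrP x0_neq0 => // h _; [left|right]. Qed.

Lemma cs_phase : cs (phase p E) = p / speed p E.
Proof.
have [_ e _] := gacosP a0 ratio_itv; rewrite /phase.
by case: sg_x0_case => -[-> _]; rewrite ?mul1r ?mulN1r ?gcosN.
Qed.

Lemma sn_phase : sn (phase p E) = Num.sg x0 * sn (gacos a (p / speed p E)).
Proof. by rewrite /phase; case: sg_x0_case => -[-> _]; rewrite ?mul1r ?mulN1r ?gsinN. Qed.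

Lemma phase_itv : - gpi R a < phase p E < gpi R a.
Proof.
have [/andP[h1 h2] _ _] := gacosP a0 ratio_itv; have q := gpi_gt0 R a0; rewrite /phase.
by case: sg_x0_case => -[-> _]; rewrite ?mul1r ?mulN1r; apply/andP; split; lra.
Qed.

Lemma sn_phase_x0 : 0 < sn (phase p E) / x0.
Proof.
have [h _ _] := gacosP a0 ratio_itv; have q := gsin_gt0 a0 h; rewrite sn_phase.
case: sg_x0_case => -[-> x0s]; rewrite ?mul1r ?mulN1r; first exact: divr_gt0.
by rewrite mulNr -mulrN -invrN divr_gt0 // oppr_gt0.
Qed.

Lemma sn_phase_neq0 : sn (phase p E) != 0.
Proof. by apply/eqP => h; have := sn_phase_x0; rewrite h mul0r ltxx. Qed.

Lemma freq_gt0 : 0 < freq p E.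
Proof. by rewrite /freq -mulrA mulr_gt0 ?speed_gt0 ?sn_phase_x0. Qed.

Lemma E_phase : E = speed p E ^+ 2 * sn (phase p E) ^+ (2 * a) / x0 ^+ (2 * a).
Proof.
have v0 := lt0r_neq0 speed_gt0; have X0 := lt0r_neq0 x0X_gt0.
have := gcos_gsin a0 (phase p E); rewrite cs_phase => e.
have -> : sn (phase p E) ^+ (2 * a) = 1 - (p / speed p E) ^+ 2 by lra.
have -> : speed p E ^+ 2 * (1 - (p / speed p E) ^+ 2) = speed p E ^+ 2 - p ^+ 2 by field.
by rewrite speedK /level_energy; field.
Qed.

Lemma phase_scale t : 0 < t -> phase (t * p) (t ^+ 2 * E) = phase p E.
Proof.
move=> t0; rewrite /phase; congr (_ * gacos _ _).
rewrite speed_scale //.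
have v0 := lt0r_neq0 speed_gt0; have t0' := lt0r_neq0 t0.
by field; apply/andP.
Qed.

End a_pos.

Lemma freq_scale t p E : (0 < a)%N -> 0 < E -> 0 < t ->
  freq (t * p) (t ^+ 2 * E) = t * freq p E.
Proof. by move=> a0 E0 t0; rewrite /freq phase_scale // speed_scale //; ring. Qed.

Lemma angle_scale s t p E : (0 < a)%N -> 0 < E -> 0 < t ->
  angle s (t * p) (t ^+ 2 * E) = angle (t * s) p E.
Proof. by move=> a0 E0 t0; rewrite /angle phase_scale // freq_scale //; ring. Qed.

Lemma orbit_x_scale s t p E : 0 < E -> 0 < t -> orbit_x s (t * p) (t ^+ 2 * E) =
  orbit_x (t * s) p E.
Proof.
move=> E0 t0; rewrite /orbit_x; case: eqP => [_|/eqP]; first by ring.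
by rewrite -lt0n => a0; rewrite angle_scale // phase_scale.
Qed.

Lemma orbit_p_scale s t p E : 0 < E -> 0 < t -> orbit_p s (t * p) (t ^+ 2 * E) =
  t * orbit_p (t * s) p E.
Proof.
move=> E0 t0; rewrite /orbit_p; case: eqP => [//|/eqP].
by rewrite -lt0n => a0; rewrite angle_scale // speed_scale // mulrA.
Qed.

Lemma orbit_clock_scale s t p E : 0 < E -> 0 < t ->
  orbit_clock s (t * p) (t ^+ 2 * E) = orbit_clock (t * s) p E / t.
Proof.
move=> E0 t0; rewrite /orbit_clock orbit_x_scale // orbit_p_scale // level_energy_scale.
have n1 : (1 + a)%:R != 0 :> R by rewrite pnatr_eq0.
by field; rewrite !lt0r_neq0.
Qed.

End one_degree.

(** The Gauss lemma of a level in the coordinates (speed, phase), where [p] and [E] are monomials.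
    C, S, M stand for cos_a, sin_a, sin_a^(2a-1) at the angle reached, c, g, m for the same at the
    phase, and X for x0^(2a). Treating these as free variables tied by the two Pythagorean relations
    makes the claim a rational identity. *)
Lemma action_algebra (F : fieldType) (al v x0 C S M c g m s ds dv dph X : F) :
  1 + al != 0 -> v != 0 -> x0 != 0 -> g != 0 -> m != 0 -> X != 0 -> 2 != 0 :> F ->
  C ^+ 2 + S * M = 1 -> c ^+ 2 + g * m = 1 ->
  let p := v * c in
  let E := v ^+ 2 * (g * m) / X in
  let d_level_energy := 2 * v * dv in
  let dp := dv * c - v * al * m * dph in
  let dE := (d_level_energy - 2 * p * dp) / X in
  let du := (dv * g + v * c * dph) / x0 * s + v * g / x0 * ds + dph in
  let x := x0 * S / g in
  let P := v * C in
  let dx := x0 * (C * du * g - S * c * dph) / g ^+ 2 in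
  let dP := dv * C - v * al * M * du in
  let T := (v ^+ 2 * s - (x * P - x0 * p)) / ((1 + al) * E) in
  let dT := (d_level_energy * s + v ^+ 2 * ds - (dx * P + x * dP - x0 * dp)) / ((1 + al) * E) - T
    * dE / E in
  P * dx = v ^+ 2 * ds + s * d_level_energy / 2 - E * dT - T * dE / 2.
Proof.
move=> n1 nv nx ng nm nX n2 hC hc p E d_level_energy dp dE du x P dx dP T dT.
have em : m = (1 - c ^+ 2) / g by rewrite -hc addrC addKr mulrC mulKf.
have nc : 1 - c ^+ 2 != 0 by apply: contraNneq nm => h; rewrite em h mul0r.
apply/eqP; rewrite -subr_eq0; apply/eqP.
(* With [m] eliminated by the relation at the phase, both sides differ by this multiple of the
   relation at the angle reached. *)
transitivity (x0 * v * al * du / (g * (1 + al)) * (C ^+ 2 + S * M - 1));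
  last by rewrite hC subrr mulr0.
rewrite /dT /T /dP /dx /P /x /du /dE /dp /d_level_energy /E /p em.
field; rewrite n1 nv nx ng nX n2 nc //.
Qed.

Lemma orbit_energy (R : realType) (a : nat) (x0 s p E : R) :
  (a != 0%N -> x0 != 0) -> 0 < E ->
  orbit_p a x0 s p E ^+ 2 + orbit_x a x0 s p E ^+ (2 * a) * E
  = level_energy a x0 p E.
Proof.
move=> x0n E0.
have [a0|an] := eqVneq a 0%N.
  by rewrite /orbit_p /level_energy a0 /= muln0 !expr0.
have a0 : (0 < a)%N by rewrite lt0n.
rewrite -(speedK x0n a0 p E0) [X in _ * X](E_phase x0n a0 p E0) /orbit_p /orbit_x (negbTE an).
set v := speed _ _ _ _; set u := angle _ _ _ _ _; set ph := phase _ _ _ _.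
have sph : gsin a ph ^+ (2 * a) != 0 by rewrite expf_neq0 //; apply: sn_phase_neq0.
have nX : x0 ^+ (2 * a) != 0 := lt0r_neq0 (x0X_gt0 x0n a0).
have hq (x y z : R) k : (x * y / z) ^+ k = x ^+ k * y ^+ k / z ^+ k by rewrite !exprMn exprVn.
have h : gsin a u ^+ (2 * a) = 1 - gcos a u ^+ 2 by rewrite -(gcos_gsin a0 u) addrAC subrr add0r.
by rewrite hq h; field; rewrite nX sph.
Qed.

(** * Derivatives of one level along an arbitrary curve of clock, momentum and energy *)

Section one_degree_derivatives.
Variables (R : realType) (a : nat) (x0 : R).
Local Notation sn := (@gsin R a).
Local Notation cs := (@gcos R a).
Hypothesis x0n : a != 0%N -> x0 != 0.
Variables (s p E : R -> R) (e ds dp dE : R).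
Hypothesis hs : is_derive e (1:R) s ds.
Hypothesis hp : is_derive e (1:R) p dp.
Hypothesis hE : is_derive e (1:R) E dE.
Hypothesis E0 : 0 < E e.

Definition d_level_energy : R := 2 * p e * dp + x0 ^+ (2 * a) * dE.

Lemma der_level_energy : is_derive e (1:R) (fun y => level_energy a x0 (p y) (E y)) d_level_energy.
Proof.
apply: (der_eq (derD (derX 2 hp) (derM (derC (x0 ^+ (2 * a)) e) hE))).
by rewrite /d_level_energy /=; ring.
Qed.

Definition d_orbit_clock (dX dP : R) : R :=
  (d_level_energy * s e + level_energy a x0 (p e) (E e) * ds
   - (dX * orbit_p a x0 (s e) (p e) (E e) + orbit_x a x0 (s e) (p e) (E e) * dP - x0 * dp)) / ((1
     + a)%:R * E e)
  - orbit_clock a x0 (s e) (p e) (E e) * dE / E e.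

Lemma der_orbit_clock (dX dP : R) :
  is_derive e (1:R) (fun y => orbit_x a x0 (s y) (p y) (E y)) dX ->
  is_derive e (1:R) (fun y => orbit_p a x0 (s y) (p y) (E y)) dP ->
  is_derive e (1:R) (fun y => orbit_clock a x0 (s y) (p y) (E y)) (d_orbit_clock dX dP).
Proof.
move=> hX hP.
have n1 : (1 + a)%:R != 0 :> R by rewrite pnatr_eq0.
have nE : E e != 0 := lt0r_neq0 E0.
have nn : (1 + a)%:R * E e != 0 by rewrite mulf_neq0.
have hN := derB (derM der_level_energy hs) (derB (derM hX hP) (derM (derC x0 e) hp)).
apply: (der_eq (derM hN (derV (f := fun y => (1 + a)%:R * E y) nn (derM (derC (1 + a)%:R e) hE)))).
rewrite /d_orbit_clock /orbit_clock.
set X := orbit_x _ _ _ _ _; set P := orbit_p _ _ _ _ _; set N := level_energy _ _ _ _.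
by field; apply/andP.
Qed.

Section a_pos.
Hypothesis a0 : (0 < a)%N.
Let v := speed a x0 (p e) (E e).
Let ph := phase a x0 (p e) (E e).
Let dv : R := d_level_energy / (2 * v).
Let dph : R := (- a%:R * sn ph ^+ (2 * a).-1)^-1 * ((dp * v - p e * dv) / v ^+ 2).

Lemma der_speed : is_derive e (1:R) (fun y => speed a x0 (p y) (E y)) dv.
Proof.
have h := derO (g := fun y => level_energy a x0 (p y) (E y)) (is_derive1_sqrt (level_energy_gt0
  x0n a0 (p e) E0)) der_level_energy.
by apply: (der_eq h); rewrite mulrC.
Qed.

Lemma der_phase : is_derive e (1:R) (fun y => phase a x0 (p y) (E y)) dph.
Proof.
have nv : v != 0 := lt0r_neq0 (speed_gt0 x0n a0 (p e) E0).
have hz := derM hp (derV (f := fun y => speed a x0 (p y) (E y)) nv der_speed).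
have [h1 h2 h3] := gacosP a0 (ratio_itv x0n a0 (p e) E0).
have h := derM (derC (Num.sg x0) e) (derO (g := fun y => p y / speed a x0 (p y) (E y)) h3 hz).
apply: (der_eq h); rewrite mul0r add0r /dph -/v.
have sphE : sn (gacos a (p e / v)) = Num.sg x0 * sn ph.
  by rewrite /ph (sn_phase x0n a0) // mulrA -expr2 (sg_x0 x0n a0) mul1r.
have sph : sn ph != 0 by apply: sn_phase_neq0.
have na : a%:R != 0 :> R by rewrite pnatr_eq0 -lt0n.
rewrite sphE.
(* The exponent 2a - 1 is odd and the sign squares to 1, so exactly one factor of the sign
   survives. *)
have -> : (Num.sg x0 * sn ph) ^+ (2 * a).-1 = Num.sg x0 * sn ph ^+ (2 * a).-1.
  rewrite exprMn; congr (_ * _); have -> : (2 * a).-1 = (2 * a.-1).+1 by lia.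
  by rewrite exprS exprM (sg_x0 x0n a0) expr1n mulr1.
have sm : sn ph ^+ (2 * a).-1 != 0 by rewrite expf_neq0.
by case: (sg_x0_case x0n a0) => -[-> _]; field; rewrite ?na ?sm ?nv ?oppr_eq0 ?oner_eq0.
Qed.

Let dfreq : R := (dv * sn ph + v * cs ph * dph) / x0.

Lemma der_freq : is_derive e (1:R) (fun y => freq a x0 (p y) (E y)) dfreq.
Proof.
have h := derM (derM der_speed (derO (g := fun y =>
  phase a x0 (p y) (E y)) (der_gsin a0 ph) der_phase)) (derC x0^-1 e).
by apply: (der_eq h); rewrite /dfreq -/v -/ph; ring.
Qed.

Let u := angle a x0 (s e) (p e) (E e).
Let du : R := dfreq * s e + freq a x0 (p e) (E e) * ds + dph.

Lemma der_angle : is_derive e (1:R) (fun y => angle a x0 (s y) (p y) (E y)) du.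
Proof. exact: (derD (derM der_freq hs) der_phase). Qed.

Let dX : R := x0 * (cs u * du * sn ph - sn u * cs ph * dph) / sn ph ^+ 2.
Let dP : R := dv * cs u - v * a%:R * sn u ^+ (2 * a).-1 * du.

Let an0 : (a == 0%N) = false. Proof. by rewrite eqn0Ngt a0. Qed.

Lemma der_orbit_x : is_derive e (1:R) (fun y => orbit_x a x0 (s y) (p y) (E y)) dX.
Proof.
have sph : sn ph != 0 by apply: sn_phase_neq0.
rewrite /orbit_x an0.
have h1 := derO (g := fun y => angle a x0 (s y) (p y) (E y)) (der_gsin a0 u) der_angle.
have h2 := derO (g := fun y => phase a x0 (p y) (E y)) (der_gsin a0 ph) der_phase.
have h := derM (derM (derC x0 e) h1) (derV (f := fun y => sn (phase a x0 (p y) (E y))) sph h2).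
by apply: (der_eq h); rewrite /dX -/u -/ph; field.
Qed.

Lemma der_orbit_p : is_derive e (1:R) (fun y => orbit_p a x0 (s y) (p y) (E y)) dP.
Proof.
rewrite /orbit_p an0.
have h := derM der_speed (derO (g := fun y => angle a x0 (s y) (p y) (E y)) (der_gcos a0 u)
  der_angle).
by apply: (der_eq h); rewrite /dP -/u -/v; ring.
Qed.

Lemma action_identity_pos :
  orbit_p a x0 (s e) (p e) (E e) * dX = level_energy a x0 (p e) (E e) * ds + s e * d_level_energy
    / 2
    - E e * d_orbit_clock dX dP - orbit_clock a x0 (s e) (p e) (E e) * dE / 2.
Proof.
have nv : v != 0 := lt0r_neq0 (speed_gt0 x0n a0 (p e) E0).
have sph : sn ph != 0 by apply: sn_phase_neq0.
have nx : x0 != 0 := x0_neq0 x0n a0.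
have nX : x0 ^+ (2 * a) != 0 := lt0r_neq0 (x0X_gt0 x0n a0).
have nE : E e != 0 := lt0r_neq0 E0.
have na : a%:R != 0 :> R by rewrite pnatr_eq0 -lt0n.
have n1 : (1 + a)%:R != 0 :> R by rewrite pnatr_eq0.
have eN : (1 + a)%:R = 1 + a%:R :> R by rewrite natrD.
have na1 : 1 + a%:R != 0 :> R by rewrite -eN.
have n2 : 2 != 0 :> R by rewrite pnatr_eq0.
have sm : sn ph ^+ (2 * a).-1 != 0 by rewrite expf_neq0.
have cph : p e = v * cs ph by rewrite cs_phase // mulrC divfK.
have hu := gcos_gsin a0 u; have hph := gcos_gsin a0 ph; rewrite -!gsinXodd // in hu hph.
have hen : level_energy a x0 (p e) (E e) = v ^+ 2 by rewrite speedK.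
have hE' : E e = v ^+ 2 * (sn ph * sn ph ^+ (2 * a).-1) / x0 ^+ (2 * a).
  by rewrite gsinXodd //; apply: E_phase.
have hden : d_level_energy = 2 * v * dv by rewrite /dv; field.
have hdp : dp = dv * cs ph - v * a%:R * sn ph ^+ (2 * a).-1 * dph.
  by rewrite /dph cph; field; rewrite na sm nv.
have hdE : dE = (d_level_energy - 2 * p e * dp) / x0 ^+ (2 * a) by rewrite /d_level_energy; field.
have := @action_algebra R a%:R v x0 (cs u) (sn u) (sn u ^+ (2 * a).-1) (cs ph) (sn ph)
  (sn ph ^+ (2 * a).-1) (s e) ds dv dph (x0 ^+ (2 * a)) na1 nv nx sph sm nX n2 hu hph.
have edu : du = (dv * sn ph + p e * dph) / x0 * s e + v * sn ph / x0 * ds + dph.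
  by rewrite [in RHS]cph.
rewrite /= -hden -hdp -cph -hE' -hdE -edu => H.
by rewrite /d_orbit_clock /orbit_clock hen /orbit_x /orbit_p an0 eN; exact: H.
Qed.

(** With its energy fixed a level keeps its speed, so the phase carries the whole variation: dp = -
    a v sin_a^(2a-1) dphase. Position, depending on the phase also through the frequency, then moves
    proportionally to dphase, hence to dp. *)
Lemma conjugate_identity_pos : d_level_energy = 0 -> ds = 0 ->
  dX = conj_coef a x0 (s e) (p e) (E e) * dp.
Proof.
move=> den0 ds0.
have nv : v != 0 := lt0r_neq0 (speed_gt0 x0n a0 (p e) E0).
have sph : sn ph != 0 by apply: sn_phase_neq0.
have nx : x0 != 0 := x0_neq0 x0n a0.
have na : a%:R != 0 :> R by rewrite pnatr_eq0 -lt0n.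
have sm : sn ph ^+ (2 * a).-1 != 0 by rewrite expf_neq0.
have hm : sn ph ^+ (2 * a).+1 = sn ph ^+ 2 * sn ph ^+ (2 * a).-1.
  by rewrite -exprD; congr (_ ^+ _); lia.
have cph : p e = v * cs ph by rewrite cs_phase // mulrC divfK.
have dv0 : dv = 0 by rewrite /dv den0 mul0r.
have hdph : dph = - dp / (v * a%:R * sn ph ^+ (2 * a).-1).
  by rewrite /dph dv0; field; rewrite na sm nv.
rewrite /conj_coef an0 hm /conj_fun -/ph -/v.
have -> : phase a x0 (p e) (E e) + freq a x0 (p e) (E e) * s e = u by rewrite addrC.
rewrite /dX /du /dfreq ds0 dv0 hdph /freq -/v -/ph.
by field; rewrite na sm nv nx sph.
Qed.

Lemma flow_identities_pos : dp = 0 -> dE = 0 ->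
  dX = orbit_p a x0 (s e) (p e) (E e) * ds /\
  dP = - (a%:R * orbit_x a x0 (s e) (p e) (E e) ^+ (2 * a).-1 * E e) * ds.
Proof.
move=> dp0 dE0.
have nv : v != 0 := lt0r_neq0 (speed_gt0 x0n a0 (p e) E0).
have sph : sn ph != 0 by apply: sn_phase_neq0.
have nx : x0 != 0 := x0_neq0 x0n a0.
have dv0 : dv = 0 by rewrite /dv /d_level_energy dp0 dE0 !mulr0 addr0 mul0r.
have dph0 : dph = 0 by rewrite /dph dp0 dv0; ring.
have hE' : E e = v ^+ 2 * (sn ph * sn ph ^+ (2 * a).-1) / x0 ^+ (2 * a).
  by rewrite gsinXodd //; apply: E_phase.
have hx : x0 ^+ (2 * a) = x0 * x0 ^+ (2 * a).-1 by rewrite -exprS prednK // muln_gt0.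
rewrite /dX /dP /du /dfreq dv0 dph0 /orbit_p /orbit_x an0 -/u -/v -/ph /freq -/v -/ph hE'.
split; first by field; rewrite nx sph.
have sm : sn ph ^+ (2 * a).-1 != 0 by rewrite expf_neq0.
have sx : x0 ^+ (2 * a).-1 != 0 by rewrite expf_neq0.
have hq (x y z : R) k : (x * y / z) ^+ k = x ^+ k * y ^+ k / z ^+ k by rewrite !exprMn exprVn.
rewrite hx hq.
by field; rewrite sm sx nx.
Qed.

End a_pos.
(** One computation serves two purposes. Along a variation of the covector the first two clauses are
    the Gauss lemma, with right-hand side B_k - B_(k+1), and the conjugate coefficient. Along time,
    where dp = dE = 0, the last clause gives the equations of motion and the speed of the next
    clock. *)
Lemma stage_derivative : exists dX dP dT : R,
  [/\ is_derive e (1:R) (fun y => orbit_x a x0 (s y) (p y) (E y)) dX,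
      is_derive e (1:R) (fun y => orbit_p a x0 (s y) (p y) (E y)) dP &
      is_derive e (1:R) (fun y => orbit_clock a x0 (s y) (p y) (E y)) dT] /\
  [/\ orbit_p a x0 (s e) (p e) (E e) * dX = level_energy a x0 (p e) (E e) * ds + s e *
    d_level_energy / 2
        - E e * dT - orbit_clock a x0 (s e) (p e) (E e) * dE / 2,
      d_level_energy = 0 -> ds = 0 -> dX = conj_coef a x0 (s e) (p e) (E e) * dp &
      dp = 0 -> dE = 0 ->
        [/\ dX = orbit_p a x0 (s e) (p e) (E e) * ds,
            dP = - (a%:R * orbit_x a x0 (s e) (p e) (E e) ^+ (2 * a).-1 * E e) * ds &
            dT = orbit_x a x0 (s e) (p e) (E e) ^+ (2 * a) * ds]].
Proof.
have nE : E e != 0 := lt0r_neq0 E0.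
have n1 : (1 + a)%:R != 0 :> R by rewrite pnatr_eq0.
suff [dX [dP [hX hP] [h1 h2 h3]]] : exists dX, exists2 dP : R,
    is_derive e (1:R) (fun y => orbit_x a x0 (s y) (p y) (E y)) dX /\
    is_derive e (1:R) (fun y => orbit_p a x0 (s y) (p y) (E y)) dP &
    [/\ orbit_p a x0 (s e) (p e) (E e) * dX = level_energy a x0 (p e) (E e) * ds + s e *
      d_level_energy / 2
        - E e * d_orbit_clock dX dP - orbit_clock a x0 (s e) (p e) (E e) * dE / 2,
      d_level_energy = 0 -> ds = 0 -> dX = conj_coef a x0 (s e) (p e) (E e) * dp &
      dp = 0 -> dE = 0 ->
        dX = orbit_p a x0 (s e) (p e) (E e) * ds /\
        dP = - (a%:R * orbit_x a x0 (s e) (p e) (E e) ^+ (2 * a).-1 * E e) * ds].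
  exists dX, dP, (d_orbit_clock dX dP); split.
    by split; [exact: hX|exact: hP|exact (der_orbit_clock hX hP)].
  split; [exact: h1|exact: h2|move=> dp0 dE0].
  have [eX eP] := h3 dp0 dE0; split; [exact: eX|exact: eP|].
  rewrite /d_orbit_clock /d_level_energy dp0 dE0 eX eP -(orbit_energy (s e) (p e) x0n E0).
  set X := orbit_x _ _ _ _ _; set P := orbit_p _ _ _ _ _.
  (* The truncated predecessor (2 * a).-1 is 0 at a = 0, so a factor X can be split off only for a >
     0. *)
  have -> : X ^+ (2 * a) = if a == 0%N then 1 else X * X ^+ (2 * a).-1.
    case: eqP => [->|/eqP an]; first by rewrite muln0 expr0.
    have {1}-> : (2 * a = (2 * a).-1.+1)%N by move: an; lia.
    exact: exprS.
  case: eqP => [->|_]; first by field.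
  have eN : (1 + a)%:R = 1 + a%:R :> R by rewrite natrD.
  by rewrite eN in n1 *; field; rewrite nE n1.
have [a0|an] := eqVneq a 0%N; last first.
  have a0 : (0 < a)%N by rewrite lt0n.
  eexists; eexists.
    split; [exact (der_orbit_x a0)|exact (der_orbit_p a0)].
  split; [exact: action_identity_pos|exact: conjugate_identity_pos|exact: flow_identities_pos].
have n10 : (1 + 0)%:R = 1 :> R by rewrite addn0.
exists (dp * s e + p e * ds), dp.
  split; last by rewrite /orbit_p a0 /=; exact: hp.
  by rewrite /orbit_x a0 /=; apply: (der_eq (derD (derC x0 e) (derM hp hs))); rewrite add0r.
rewrite /d_orbit_clock /orbit_clock /orbit_p /orbit_x /conj_coef /level_energy /d_level_energy a0
  /= muln0 !expr0; split.
- by field.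
- by move=> _ ->; rewrite mulr0 addr0 mulrC.
- by move=> -> _; split; ring.
Qed.

End one_degree_derivatives.

Section one_degree_start.
Variables (R : realType) (a : nat) (x0 p E : R).
Hypothesis x0n : a != 0%N -> x0 != 0.
Hypothesis E0 : 0 < E.

Lemma orbit_x0 : orbit_x a x0 0 p E = x0.
Proof.
rewrite /orbit_x; case: eqP => [_|/eqP an]; first by rewrite mulr0 addr0.
have a0 : (0 < a)%N by rewrite lt0n.
by rewrite /angle mulr0 add0r mulfK // sn_phase_neq0.
Qed.

Lemma orbit_p0 : orbit_p a x0 0 p E = p.
Proof.
rewrite /orbit_p; case: eqP => [//|/eqP an].
have a0 : (0 < a)%N by rewrite lt0n.
by rewrite /angle mulr0 add0r cs_phase // mulrC divfK // lt0r_neq0 // speed_gt0.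
Qed.

Lemma orbit_clock0 : orbit_clock a x0 0 p E = 0.
Proof. by rewrite /orbit_clock orbit_x0 orbit_p0 subrr mulr0 subr0 mul0r. Qed.

End one_degree_start.

(** * Explicit geodesics *)

Lemma exprXX_gt0 (R : realType) (a : nat) (x : R) : (a != 0%N -> x != 0) -> 0 < x ^+ (2 * a).
Proof.
have [->|a0 /(_ isT) x0] := eqVneq a 0%N; first by rewrite muln0 expr0.
by rewrite exprM exprn_gt0 // exprn_even_gt0.
Qed.

Section reduced_energy.
Variables (R : realType) (N : nat) (al : nat -> nat).
Implicit Types x p : nat -> R.

(** The energy of level k calls that of level k+1, so the recursion runs on the number [d] of levels
    still above. *)
Fixpoint energy_rec x p (d k : nat) : R :=
  if d is d'.+1 then level_energy (al k) (x k) (p k) (energy_rec x p d' k.+1) else 0.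

Definition energy x p (k : nat) : R := energy_rec x p (N.+1 - k) k.

Definition weight x (k : nat) : R := \prod_(i < k) x i ^+ al i.

Lemma energyS x p k : (k <= N)%N -> energy x p k =
  level_energy (al k) (x k) (p k) (energy x p k.+1).
Proof. by move=> kN; rewrite /energy subSS subSn. Qed.

Lemma energy_end x p : energy x p N.+1 = 0.
Proof. by rewrite /energy subnn. Qed.

Lemma energy_last x p : energy x p N = p N ^+ 2.
Proof. by rewrite energyS // energy_end /level_energy mulr0 addr0. Qed.

(** Downward induction from the last level, the direction in which energies are built; clocks are
    built upward from level 0. *)
Lemma energy_down (P : nat -> Prop) : P N ->
  (forall k, (k < N)%N -> P k.+1 -> P k) -> forall k, (k <= N)%N -> P k.
Proof.
move=> PN PS k kN; rewrite -(subKn kN); move: (N - k)%N (leq_subr k N).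
elim=> [|d ih] dN; first by rewrite subn0.
apply: PS; first by lia.
by rewrite subnSK //; apply: ih; exact: ltnW.
Qed.

Lemma energy_gt0 x p : p N != 0 -> (forall k, (k < N)%N -> al k != 0%N -> x k != 0) ->
  forall k, (k <= N)%N -> 0 < energy x p k.
Proof.
move=> pN xn; apply: energy_down; first by rewrite energy_last exprn_even_gt0.
move=> k kN Ek; rewrite (energyS _ _ (ltnW kN)) /level_energy ltr_wpDl ?sqr_ge0 // mulr_gt0 //.
by apply: exprXX_gt0; exact: xn.
Qed.

End reduced_energy.

Section explicit_flow.
Variables (R : realType) (N : nat) (al : nat -> nat) (x0 : nat -> R).
Hypothesis alN : al N = 0%N.
Hypothesis x0n : forall k, (k < N)%N -> al k != 0%N -> x0 k != 0.
Implicit Types (t : R) (p : nat -> R).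

Fixpoint clock t p (k : nat) : R :=
  if k is k'.+1 then orbit_clock (al k') (x0 k') (clock t p k') (p k') (energy N al x0 p k) else t.

Definition flow_x t p k : R := orbit_x (al k) (x0 k) (clock t p k) (p k) (energy N al x0 p k.+1).
Definition flow_p t p k : R := orbit_p (al k) (x0 k) (clock t p k) (p k) (energy N al x0 p k.+1).

Lemma clockS t p k : clock t p k.+1 = orbit_clock (al k) (x0 k) (clock t p k) (p k) (energy N al
  x0 p k.+1).
Proof. by []. Qed.

Lemma flow_x_last t p : flow_x t p N = x0 N + p N * clock t p N.
Proof. by rewrite /flow_x /orbit_x alN. Qed.

Lemma flow_p_last t p : flow_p t p N = p N.
Proof. by rewrite /flow_p /orbit_p alN. Qed.

Variable p : nat -> R.
Hypothesis pN : p N != 0.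

Let E0 k : (k < N)%N -> 0 < energy N al x0 p k.+1.
Proof. by move=> kN; apply: (energy_gt0 pN x0n). Qed.

Lemma clock0 k : (k <= N)%N -> clock 0 p k = 0.
Proof.
elim: k => //= k ih kN; rewrite ih ?(ltnW kN) //; apply: orbit_clock0; first exact: x0n.
exact: E0.
Qed.

Lemma flow_x0 k : (k <= N)%N -> flow_x 0 p k = x0 k.
Proof.
rewrite leq_eqVlt => /orP[/eqP->|kN]; first by rewrite flow_x_last clock0 // mulr0 addr0.
by rewrite /flow_x clock0 ?(ltnW kN) // orbit_x0 //; [exact: x0n|exact: E0].
Qed.

Lemma flow_p0 k : (k <= N)%N -> flow_p 0 p k = p k.
Proof.
rewrite leq_eqVlt => /orP[/eqP->|kN]; first by rewrite flow_p_last.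
by rewrite /flow_p clock0 ?(ltnW kN) // orbit_p0 //; [exact: x0n|exact: E0].
Qed.

Lemma energy_flow t k : (k <= N)%N -> energy N al (flow_x t p) (flow_p t p) k = energy N al x0 p k.
Proof.
move: k; apply: energy_down; first by rewrite !energy_last flow_p_last.
move=> k kN ih; have hk := ltnW kN.
rewrite (@energyS R N al (flow_x t p) _ k hk) ih (@energyS R N al x0 p k hk).
exact: orbit_energy (x0n kN) (E0 kN).
Qed.

Lemma weightS x k : weight al x k.+1 = weight al x k * x k ^+ al k :> R.
Proof. by rewrite /weight big_ord_recr. Qed.

Lemma der_flow t k : (k <= N)%N ->
  [/\ is_derive t (1:R) (fun t => clock t p k) (weight al (flow_x t p) k ^+ 2),
      is_derive t (1:R) (fun t => flow_x t p k) (weight al (flow_x t p) k ^+ 2 * flow_p t p k) &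
      is_derive t (1:R) (fun t => flow_p t p k)
       (- ((al k)%:R * flow_x t p k ^+ (2 * al k).-1 * energy N al x0 p k.+1) * weight al (flow_x
         t p) k ^+ 2)].
Proof.
have der_st j : (j < N)%N -> is_derive t (1:R) (fun t =>
  clock t p j) (weight al (flow_x t p) j ^+ 2) ->
  [/\ is_derive t (1:R) (fun t => clock t p j.+1) (weight al (flow_x t p) j.+1 ^+ 2),
      is_derive t (1:R) (fun t => flow_x t p j) (weight al (flow_x t p) j ^+ 2 * flow_p t p j) &
      is_derive t (1:R) (fun t => flow_p t p j)
       (- ((al j)%:R * flow_x t p j ^+ (2 * al j).-1 * energy N al x0 p j.+1) * weight al (flow_x
         t p) j ^+ 2)].
  move=> jN h.
  have [dX [dP [dT [[hX hP hT] [_ _ h3]]]]] :=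
    stage_derivative (x0n jN) h (derC (p j) t) (derC (energy N al x0 p j.+1) t) (E0 jN).
  have [eX eP eT] := h3 erefl erefl; split.
  - apply: (der_eq hT); rewrite eT weightS exprMn -/(flow_x t p j) -exprM.
    by rewrite [(al j * 2)%N]mulnC mulrC.
  - by apply: (der_eq hX); rewrite eX mulrC.
  - exact: (der_eq hP).
have htm : (k <= N)%N -> is_derive t (1:R) (fun t => clock t p k) (weight al (flow_x t p) k ^+ 2).
  elim: k => [|k ih] kN; first by rewrite /weight big_ord0 expr1n; exact: derid.
  by have [] := der_st k kN (ih (ltnW kN)).
move=> kN; move: (kN); rewrite leq_eqVlt => /orP[/eqP eN|kN'].
  split; first exact: htm.
  - rewrite eN in htm *; rewrite flow_p_last.
    have -> : (fun t => flow_x t p N) = (fun t => x0 N + p N * clock t p N) by apply/funext => u;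
      rewrite flow_x_last.
    apply: (der_eq (derD (derC (x0 N) t) (derM (derC (p N) t) (htm (leqnn N))))).
    by rewrite mul0r !add0r mulrC.
  - rewrite eN alN !mul0r oppr0 mul0r.
    have -> : (fun t => flow_p t p N) = (fun t => p N) by apply/funext => u; rewrite flow_p_last.
    exact: derC.
by have [_ h1 h2] := der_st k kN' (htm kN); split => //; exact: htm.
Qed.

End explicit_flow.

(** * Uniqueness *)

Lemma continuousX (R : realType) (f : R -> R) (n : nat) (t : R) :
  {for t, continuous f} -> {for t, continuous (fun t => f t ^+ n)}.
Proof. by move=> cf; exact: (@continuous_comp _ _ _ f (fun x =>
  x ^+ n) t cf (@exprn_continuous R n (f t))). Qed.

Lemma continuous_sum_ord (R : realType) (F : nat -> R -> R) (n : nat) (t : R) :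
  (forall i, {for t, continuous (F i)}) -> {for t, continuous (fun u => \sum_(i < n) F i u)}.
Proof.
move=> cF; elim: n => [|n ih].
  have -> : (fun u => \sum_(i < 0) F i u) = (fun=> 0) by apply/funext => u; rewrite big_ord0.
  exact: cvg_cst.
have -> : (fun u => \sum_(i < n.+1) F i u) = (fun u => \sum_(i < n) F i u + F n u).
  by apply/funext => u; rewrite big_ord_recr.
by apply: cvgD; [exact: ih|exact: cF].
Qed.

(** d(t) exp(-K t) is nonincreasing on [0, T], starts at 0 and stays nonnegative. *)
Lemma gronwall_zero (R : realType) (d d' : R -> R) (K T : R) : 0 <= T ->
  (forall t, is_derive t (1:R) d (d' t)) ->
  (forall t, 0 <= t <= T -> d' t <= K * d t) ->
  (forall t, 0 <= d t) -> d 0 = 0 -> d T = 0.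
Proof.
rewrite le_eqVlt => /orP[/eqP<-//|T0] hd hK dge d0.
pose g t := d t * expR (- K * t).
have hg t : is_derive t (1:R) g ((d' t - K * d t) * expR (- K * t)).
  have he := derO (g := fun t => - K * t) (is_derive_expR (- K * t)) (derM (derC (- K) t) (derid
    t)).
  by apply: (der_eq (derM (hd t) he)); ring.
have [c /andP[c1 c2] e] := mean_value T0 hg.
have : g T - g 0 <= 0.
  rewrite e; apply: mulr_le0_ge0; last by rewrite subr0 ltW.
  apply: mulr_le0_ge0; last exact: expR_ge0.
  rewrite subr_le0; apply: hK; apply/andP; split; exact: ltW.
rewrite /g d0 mul0r subr0 => h; apply/eqP; rewrite eq_le dge andbT.
by move: h; rewrite pmulr_lle0 // expR_gt0.
Qed.

Lemma continuous_bounded (R : realType) (f : R -> R) (T : R) : 0 <= T ->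
  (forall t, {for t, continuous f}) -> exists K, forall t, 0 <= t <= T -> `|f t| <= K.
Proof.
move=> T0 cf.
have cw : {within `[0, T], continuous (fun t => `|f t|)}.
  by apply: continuous_subspaceT => t; apply: continuous_comp; [exact: cf|exact: norm_continuous].
have [c _ hc] := EVT_max T0 cw.
by exists `|f c| => t t0; apply: hc; rewrite in_itv.
Qed.

(* [x' = w p, p' = - a E w x^(2 a - 1)] has a locally Lipschitz right-hand side. *)
Lemma stage_unique (R : realType) (a : nat) (E : R) (w w' x p y r : R -> R) (T : R) :
  (forall t, {for t, continuous w}) ->
  (forall t, is_derive t (1:R) x (w t * p t)) ->
  (forall t, is_derive t (1:R) p (- (a%:R * x t ^+ (2 * a).-1 * E) * w t)) ->
  (forall t, is_derive t (1:R) y (w' t * r t)) ->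
  (forall t, is_derive t (1:R) r (- (a%:R * y t ^+ (2 * a).-1 * E) * w' t)) ->
  0 <= T -> (forall t, 0 <= t <= T -> w t = w' t) ->
  x 0 = y 0 -> p 0 = r 0 -> x T = y T /\ p T = r T.
Proof.
move=> cw hx hp hy hr T0 ww x00 p00.
pose m := (2 * a).-1.
(* The difference quotient of z^(2a-1) between [x t] and [y t], which bounds the nonlinearity
   without a Lipschitz constant. *)
pose M t := \sum_(i < m) x t ^+ (m.-1 - i) * y t ^+ i.
have hM t : x t ^+ m - y t ^+ m = (x t - y t) * M t.
  by rewrite subrXX; congr (_ * _); apply: eq_bigr => i _; congr (_ ^+ _ * _); lia.
have cx t : {for t, continuous x} := is_derive_continuous (hx t).
have cy t : {for t, continuous y} := is_derive_continuous (hy t).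
have cM t : {for t, continuous M}.
  apply: (@continuous_sum_ord _ (fun i t => x t ^+ (m.-1 - i) * y t ^+ i)) => i.
  by apply: cvgM; exact: continuousX.
(* The derivative of the squared distance [d] is kp (x - y) (p - r), and the product is at most [d]
   in absolute value, so a bound for [kp] on [0, T] is a Gronwall constant. *)
pose kp t := 2 * w t * (1 - a%:R * E * M t).
have ck t : {for t, continuous kp}.
  apply: cvgM; first by apply: cvgM; [exact: cvg_cst|exact: cw].
  apply: cvgB; first exact: cvg_cst.
  by apply: cvgM; [exact: cvg_cst|exact: cM].
have [K hK] := continuous_bounded T0 ck.
pose d t := (x t - y t) ^+ 2 + (p t - r t) ^+ 2.
have hd t := derD (derX 2 (derB (hx t) (hy t))) (derX 2 (derB (hp t) (hr t))).
have : d T = 0.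
  apply: (gronwall_zero (K := K) T0 hd).
  - move=> t tT; rewrite -(ww t tT) /=.
    set X := x t; set Y := y t; set P := p t; set Q := r t.
    have -> : 2 * (X - Y) ^+ 1 * (w t * P - w t * Q) +
      2 * (P - Q) ^+ 1 * (- (a%:R * X ^+ (2 * a).-1 * E) * w t - - (a%:R * Y ^+ (2 * a).-1 * E) *
        w t)
      = kp t * ((X - Y) * (P - Q)).
      transitivity (2 * w t * (X - Y) * (P - Q) - 2 * (P - Q) * a%:R * E * w t * (X ^+ m - Y ^+ m)).
        by rewrite /m; ring.
      by rewrite hM /kp -/X -/Y; ring.
    have h1 : kp t * ((X - Y) * (P - Q)) <= `|kp t| * `|(X - Y) * (P - Q)|.
      by rewrite -normrM ler_norm.
    have h2 : `|(X - Y) * (P - Q)| <= (X - Y) ^+ 2 + (P - Q) ^+ 2.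
      rewrite ler_norml; apply/andP; split.
        have := sqr_ge0 ((X - Y) + (P - Q)); have := sqr_ge0 (X - Y);
          have := sqr_ge0 (P - Q) => *; nra.
      have := sqr_ge0 ((X - Y) - (P - Q)); have := sqr_ge0 (X - Y); have := sqr_ge0 (P - Q) => *;
        nra.
    apply: (le_trans h1); apply: ler_pM => //; exact: hK.
  - by move=> t; rewrite addr_ge0 ?sqr_ge0.
  - by rewrite x00 p00 !subrr expr0n addr0.
move/eqP; rewrite paddr_eq0 ?sqr_ge0 // !sqrf_eq0 !subr_eq0 => /andP[/eqP -> /eqP ->].
by [].
Qed.

Section hamiltonian_system.
Variables (R : realType) (N : nat) (al : nat -> nat).

Definition ham_seq (x p : R -> nat -> R) : Prop := forall t k, (k <= N)%N ->
  is_derive t (1:R) (fun t => x t k) (weight al (x t) k ^+ 2 * p t k) /\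
  is_derive t (1:R) (fun t => p t k)
   (- ((al k)%:R * x t k ^+ (2 * al k).-1 * energy N al (x t) (p t) k.+1) * weight al (x t) k ^+ 2).

(** Once E_(k+1) is constant, level k is a particle in the potential x^(2 a_k) E_(k+1), run in its
    own clock, and E_k is its energy. *)
Lemma energy_conserved x p : ham_seq x p ->
  forall k t, (k <= N.+1)%N -> energy N al (x t) (p t) k = energy N al (x 0) (p 0) k.
Proof.
move=> h k t; rewrite leq_eqVlt => /orP[/eqP->|]; first by rewrite !energy_end.
have step j : (j <= N)%N -> (forall t, energy N al (x t) (p t) j.+1 =
  energy N al (x 0) (p 0) j.+1) ->
    forall t, energy N al (x t) (p t) j = energy N al (x 0) (p 0) j.
  move=> jN ih {t} t.
  apply: (derive_zero_cst (f := fun t => energy N al (x t) (p t) j)) => {}t.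
  have -> : (fun t => energy N al (x t) (p t) j) =
      (fun t => p t j ^+ 2 + x t j ^+ (2 * al j) * energy N al (x 0) (p 0) j.+1).
    by apply/funext => u; rewrite (@energyS R N al (x u) (p u) j jN) ih.
  have [hx hp] := h t j jN; rewrite ih in hp.
  apply: (der_eq (derD (derX 2 hp) (derM (derX (2 * al j) hx) (derC (energy N al (x 0) (p 0) j.+1)
    t)))).
  by rewrite natrM /=; ring.
move=> kN; move: k kN t; apply: energy_down.
  by apply: step => // t; rewrite !energy_end.
by move=> k kN ih; apply: step => //; exact: ltnW.
Qed.

Lemma weight_eq (x y : nat -> R) k : (forall i, (i < k)%N -> x i = y i) ->
  weight al x k = weight al y k.
Proof. by move=> h; apply: eq_bigr => i _; rewrite h. Qed.

Lemma weight_continuous x p k t : ham_seq x p -> (k <= N)%N -> {for t, continuous (fun t =>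
  weight al (x t) k)}.
Proof.
move=> h; elim: k => [|k ih] kN.
  have -> : (fun t => weight al (x t) 0) = (fun=> 1) by apply/funext => u; rewrite /weight big_ord0.
  exact: cvg_cst.
have -> : (fun t => weight al (x t) k.+1) = (fun t => weight al (x t) k * x t k ^+ al k).
  by apply/funext => u; rewrite weightS.
apply: cvgM; first exact: ih (ltnW kN).
apply: continuousX.
by have [hx _] := h t k (ltnW kN); exact: is_derive_continuous hx.
Qed.

(** Strong induction on the level. The conserved energy closes the equations of level k into a
    planar system whose only time dependence is the weight, and the weight involves lower levels
    only. *)
Lemma ham_seq_unique x p y r : ham_seq x p -> ham_seq y r ->
  (forall k, (k <= N)%N -> x 0 k = y 0 k) -> (forall k, (k <= N)%N -> p 0 k = r 0 k) ->
  forall k t, (k <= N)%N -> 0 <= t -> x t k = y t k.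
Proof.
move=> hx hy x0y p0r k; elim/ltn_ind: k => k ih t kN t0.
have Ek : energy N al (x 0) (p 0) k.+1 = energy N al (y 0) (r 0) k.+1.
  have H j : (j <= N)%N -> energy N al (x 0) (p 0) j = energy N al (y 0) (r 0) j.
    move: j; apply: energy_down; first by rewrite !energy_last p0r.
    move=> j jN e; have jN' := ltnW jN.
    by rewrite (@energyS R N al (x 0) (p 0) j jN') (@energyS R N al (y 0) (r 0) j jN') e x0y // p0r.
  move: kN; rewrite leq_eqVlt => /orP[/eqP->|kN]; [by rewrite !energy_end|exact: H].
have [] := @stage_unique R (al k) (energy N al (x 0) (p 0) k.+1)
  (fun t => weight al (x t) k ^+ 2) (fun t => weight al (y t) k ^+ 2)
  (fun t => x t k) (fun t => p t k) (fun t => y t k) (fun t => r t k) t => //.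
- move=> u; by apply: continuousX; exact: weight_continuous hx kN.
- by move=> u; case: (hx u k kN).
- by move=> u; rewrite -(energy_conserved hx u); [case: (hx u k kN)|].
- by move=> u; case: (hy u k kN).
- by move=> u; rewrite Ek -(energy_conserved hy u); [case: (hy u k kN)|].
- move=> u /andP[u0 _]; congr (_ ^+ 2); apply: weight_eq => i ik.
  by apply: ih => //; apply: leq_trans (ltnW ik) kN.
- exact: x0y.
- exact: p0r.
Qed.

End hamiltonian_system.

Section explicit_solution.
Variables (R : realType) (N : nat) (al : nat -> nat) (x0 p : nat -> R).
Hypothesis alN : al N = 0%N.
Hypothesis x0n : forall k, (k < N)%N -> al k != 0%N -> x0 k != 0.
Hypothesis pN : p N != 0.

Lemma flow_ham_seq : ham_seq N al (fun t => flow_x N al x0 t p) (fun t => flow_p N al x0 t p).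
Proof.
move=> u k kn; have [_ h1 h2] := der_flow alN x0n pN u kn; split; first exact: h1.
apply: (der_eq h2); case: (ltnP k N) => kn'; first by rewrite (energy_flow alN x0n pN).
have -> : k = N by lia.
by rewrite alN !mul0r.
Qed.

(** The speed of the clock, a squared weight, may vanish whenever a lower coordinate crosses 0. At
    time 0 it does not, the initial point being Riemannian, so the clock becomes positive at once
    and never decreases afterwards. *)
Lemma clock_gt0 (t : R) k : (k <= N)%N -> 0 < t -> 0 < clock N al x0 t p k.
Proof.
move=> kN t0.
pose w s := weight al (flow_x N al x0 s p) k.
have dT s : is_derive s (1:R) (fun s => clock N al x0 s p k) (w s ^+ 2).
  by have [] := der_flow alN x0n pN s kN.
have w0 : w 0 != 0.
  rewrite /w /weight prodf_seq_neq0; apply/allP => i _ /=.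
  have ik : (i < k)%N := ltn_ord i.
  rewrite (flow_x0 alN x0n pN) ?(leq_trans (ltnW ik)) //.
  have [->|an] := eqVneq (al i) 0%N; first by rewrite expr0 oner_eq0.
  by rewrite expf_neq0 // x0n // (leq_trans ik).
have cw : {for (0:R), continuous w} := weight_continuous flow_ham_seq kN.
have /nbhs_ballP[e /= e0 he] : \forall s \near (0:R), w s != 0 by move/cvgr_neq0: cw; apply.
pose h := Num.min t (e / 2).
have h0 : 0 < h by rewrite lt_min t0 divr_gt0.
have [s /andP[s0 sh] es] := mean_value h0 dT.
have : 0 < clock N al x0 h p k.
  move: es; rewrite (clock0 x0n pN kN) !subr0 => ->.
  rewrite mulr_gt0 // exprn_even_gt0 //=; apply: he.
  rewrite /ball/= sub0r normrN gtr0_norm //; apply: (lt_trans sh); rewrite /h.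
  rewrite gt_min; apply/orP; right; lra.
have [->//|ht hT] := eqVneq h t.
have ht' : h < t by rewrite lt_neqAle ht /h ge_min lexx.
have [s' _ es'] := mean_value ht' dT.
apply: (lt_le_trans hT); rewrite -subr_ge0 es' mulr_ge0 ?sqr_ge0 // subr_ge0 ltW //.
Qed.

End explicit_solution.

(** * The Hamiltonian flow on row vectors *)

Lemma derive_line (R : realType) (V : normedModType R) (f : V -> R) (x v : V) (d : R) :
  is_derive (0:R) (1:R) (fun h => f (h *: v + x)) d -> 'D_v f x = d.
Proof.
move=> [_ <-]; rewrite /derive.
suff -> : (fun h : R => h^-1 *: ((f \o shift x) (h *: v) - f x)) =
  (fun h : R => h^-1 *: (((fun h => f (h *: v + x)) \o shift 0) (h *: (1 : R)) - f (0 *: v + x)))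
    by [].
by apply/funext => h /=; rewrite addr0 scale0r add0r [h *: 1]mulr1.
Qed.

Section sequences_of_vectors.
Variables (R : realType) (n : nat) (alpha : 'I_n -> nat).

(* Junk for [k > n], where [inord k = ord0]. *)
Definition coords (x : 'rV[R]_n.+1) (k : nat) : R := x ord0 (inord k).
(* The value 0 at [n] makes the last coordinate a level with exponent 0. *)
Definition alpha_seq (k : nat) : nat := if (insub k : option 'I_n) is Some i then alpha i else 0%N.

Lemma alpha_seq_last : alpha_seq n = 0%N.
Proof. by rewrite /alpha_seq insubF // ltnn. Qed.

Lemma alpha_seq_ord (i : 'I_n) : alpha_seq i = alpha i.
Proof. by rewrite /alpha_seq insubT //= => h; congr alpha; apply: val_inj. Qed.

Lemma coords_widx (x : 'rV[R]_n.+1) (i : 'I_n) : coords x i = x ord0 (widx i).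
Proof. by rewrite /coords; congr (x _ _); apply: val_inj; rewrite /= inordK // ltnS ltnW. Qed.

Lemma coords_ord (x : 'rV[R]_n.+1) (j : 'I_n.+1) : coords x j = x ord0 j.
Proof. by rewrite /coords inord_val. Qed.

Lemma xi_weight x (j : 'I_n.+1) : xi alpha x j = weight alpha_seq (coords x) j.
Proof.
have jn : (j <= n)%N by rewrite -ltnS.
rewrite /weight (big_ord_widen n (fun i => coords x i ^+ alpha_seq i) jn).
by apply: eq_bigr => i _; rewrite alpha_seq_ord coords_widx.
Qed.

(** The term w_k^2 E_k collects what the levels from k on contribute to twice the Hamiltonian.
    Splitting at k = j isolates x_j: lower terms do not contain it, and E_j contains it only in the
    factor of E_(j+1); this is how [Ham_derive] works. *)
Lemma sum_weight_energy (x p : nat -> R) k : (k <= n)%N ->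
  \sum_(j < n.+1) weight alpha_seq x j ^+ 2 * p j ^+ 2 =
  \sum_(j < k) weight alpha_seq x j ^+ 2 * p j ^+ 2 + weight alpha_seq x k ^+ 2 * energy n
    alpha_seq x p k.
Proof.
move: k; apply: energy_down; first by rewrite big_ord_recr /= energy_last.
move=> k kn ->; rewrite big_ord_recr /= (@energyS R n alpha_seq x p k (ltnW kn)) weightS.
by rewrite /level_energy exprMn [(2 * alpha_seq k)%N]mulnC exprM; ring.
Qed.

Lemma Ham_energy x p : Ham alpha x p = 2^-1 * \sum_(j < n.+1) weight alpha_seq (coords x) j ^+ 2 *
  coords p j ^+ 2.
Proof. by rewrite /Ham; congr (_ * _); apply: eq_bigr => j _; rewrite xi_weight coords_ord. Qed.

Lemma energy_eq (x p y r : nat -> R) k : (forall i, (k <= i <= n)%N -> x i = y i) ->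
  (forall i, (k <= i <= n)%N -> p i = r i) -> (k <= n.+1)%N ->
    energy n alpha_seq x p k = energy n alpha_seq y r k.
Proof.
move=> hx hp kn; rewrite /energy.
have : (k + (n.+1 - k) <= n.+1)%N by rewrite subnKC.
move: (n.+1 - k)%N kn => d kn; elim: d k kn hx hp => //= d ih k kn hx hp h.
rewrite hx ?hp; [|lia|lia].
by congr (level_energy _ _ _ _); apply: ih => [|i ki|i ki|]; [lia|apply: hx; lia|apply: hp;
  lia|lia].
Qed.

Lemma Ham_derive (x p : 'rV[R]_n.+1) (j : 'I_n.+1) :
  'D_(delta_mx ord0 j) (fun y => Ham alpha y p) x =
  (alpha_seq j)%:R * coords x j ^+ (2 * alpha_seq j).-1 * energy n alpha_seq (coords x) (coords p)
    j.+1 * weight alpha_seq (coords x) j ^+ 2.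
Proof.
apply: derive_line.
have jn : (j <= n)%N by rewrite -ltnS.
set E := energy n alpha_seq (coords x) (coords p) j.+1.
pose y (h : R) : 'rV[R]_n.+1 := h *: delta_mx ord0 j + x.
have yj h : coords (y h) j = h + coords x j.
  by rewrite !coords_ord /y !mxE !eqxx mulr1.
have yi h i : (i <= n)%N -> i != j -> coords (y h) i = coords x i.
  move=> ik ij; rewrite /coords /y !mxE eqxx /=; case: eqP => [e|_]; last by rewrite mulr0 add0r.
  by move: ij; rewrite -(congr1 val e) /= inordK ?eqxx.
have xiny h i : (i <= j)%N -> weight alpha_seq (coords (y h)) i = weight alpha_seq (coords x) i.
  move=> ij; apply: weight_eq => k ki; apply: yi; lia.
have engy h : energy n alpha_seq (coords (y h)) (coords p) j.+1 = E.
  by apply: energy_eq => // i ji; apply: yi; lia.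
pose C := \sum_(i < j) weight alpha_seq (coords x) i ^+ 2 * coords p i ^+ 2.
have HE : (fun h : R => Ham alpha (y h) p) = (fun h =>
  2^-1 * (C + weight alpha_seq (coords x) j ^+ 2 *
    (coords p j ^+ 2 + (h + coords x j) ^+ (2 * alpha_seq j) * E))).
  apply/funext => h; rewrite Ham_energy (sum_weight_energy _ _ jn) (@energyS R n alpha_seq _ _ j
    jn) /level_energy yj engy xiny //.
  congr (_ * (_ + _)); apply: eq_bigr => i _; rewrite xiny //; exact: ltnW.
rewrite -/(y _) HE.
have h1 := derX (2 * alpha_seq j) (derD (derid (0:R)) (derC (coords x j) 0)).
apply: (der_eq (derM (derC 2^-1 (0:R)) (derD (derC C 0) (derM (derC (weight alpha_seq (coords x) j
  ^+ 2) 0)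
  (derD (derC (coords p j ^+ 2) 0) (derM h1 (derC E 0))))))).
by rewrite !add0r natrM; field.
Qed.

Lemma ham_sol_seq (x p : R -> 'rV[R]_n.+1) : ham_sol alpha x p ->
  ham_seq n alpha_seq (fun t => coords (x t)) (fun t => coords (p t)).
Proof.
move=> h t k kn; have [hx hp] := h t (inord k).
rewrite Ham_derive in hp; rewrite xi_weight in hx.
have ek : nat_of_ord (inord k : 'I_n.+1) = k by rewrite inordK.
rewrite -coords_ord ek in hx; rewrite ek in hp; split; first exact: hx.
by apply: (der_eq hp); rewrite mulNr.
Qed.

Lemma ham_seq_sol (x p : R -> nat -> R) : ham_seq n alpha_seq x p ->
  ham_sol alpha (fun t => \row_j x t j) (fun t => \row_j p t j).
Proof.
move=> h t j; have jn : (j <= n)%N by rewrite -ltnS.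
have sqr (y : nat -> R) i : (i <= n)%N -> coords (\row_j y j) i = y i.
  by move=> ik; rewrite /coords mxE inordK.
have xe (y : nat -> R) i : (i <= n)%N -> weight alpha_seq (coords (\row_j y j)) i =
  weight alpha_seq y i.
  by move=> ik; apply: weight_eq => k ki; apply: sqr; lia.
have [hx hp] := h t j jn; rewrite Ham_derive xi_weight -coords_ord !sqr // !xe //.
have fE (y : R -> nat -> R) : (fun s => (\row_j y s j : 'rV[R]_n.+1) ord0 j) = (fun s => y s j).
  by apply/funext => s; rewrite mxE.
rewrite !fE; split; first exact: hx.
have -> : energy n alpha_seq (coords (\row_j (x t j))) (coords (\row_j (p t j))) j.+1 =
  energy n alpha_seq (x t) (p t) j.+1.
  by apply: energy_eq => // i ji; apply: sqr; lia.
by apply: (der_eq hp); rewrite mulNr.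
Qed.

(** The explicit flow is one of the solutions among which [geod] chooses, and uniqueness forces
    every choice to agree with it at nonnegative times. *)
Lemma geodE (x0 p0 : 'rV[R]_n.+1) (t : R) : riemannian alpha x0 -> p0 ord0 ord_max != 0 -> 0 <= t ->
  geod alpha x0 p0 t = \row_j flow_x n alpha_seq (coords x0) t (coords p0) j.
Proof.
move=> rx pn t0.
have x0n k : (k < n)%N -> alpha_seq k != 0%N -> coords x0 k != 0.
  by move=> kn; have := rx (Ordinal kn); rewrite -alpha_seq_ord -coords_widx.
have pN : coords p0 n != 0.
  by rewrite /coords (_ : inord n = ord_max) //; apply: val_inj; rewrite /= inordK.
have hs := flow_ham_seq alpha_seq_last x0n pN.
have sol0 := ham_seq_sol hs.
apply: xget_unique.
  exists (fun t => \row_j flow_x n alpha_seq (coords x0) t (coords p0) j), (fun t =>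
    \row_j flow_p n alpha_seq (coords x0) t (coords p0) j).
  split => //; apply/rowP => j; rewrite mxE.
    by rewrite (flow_x0 alpha_seq_last x0n pN) ?coords_ord // -ltnS.
  by rewrite (flow_p0 alpha_seq_last x0n pN) ?coords_ord // -ltnS.
move=> y [x [p [hx x00 p00 ->]]]; apply/rowP => j; rewrite mxE -coords_ord.
apply: (ham_seq_unique (ham_sol_seq hx) hs) => //; last by rewrite -ltnS.
  by move=> k kn; rewrite x00 (flow_x0 alpha_seq_last x0n pN).
by move=> k kn; rewrite p00 (flow_p0 alpha_seq_last x0n pN).
Qed.

End sequences_of_vectors.

(** * The differential of the exponential map *)

Section pointwise_differentiability.
Variables (R : realType) (V : normedModType R).
Implicit Types (f g : V -> R) (q : V).

Lemma difD f g q : differentiable f q -> differentiable g q -> differentiable (fun y =>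
  f y + g y) q.
Proof. by move=> hf hg; exact: differentiableD. Qed.

Lemma difB f g q : differentiable f q -> differentiable g q -> differentiable (fun y =>
  f y - g y) q.
Proof. by move=> hf hg; exact: differentiableB. Qed.

Lemma difM f g q : differentiable f q -> differentiable g q -> differentiable (fun y =>
  f y * g y) q.
Proof. by move=> hf hg; exact: differentiableM. Qed.

Lemma difC (c : R) q : differentiable (fun=> c) q.
Proof. exact: differentiable_cst. Qed.

Lemma difO (h : R -> R) g q (d : R) : is_derive (g q) (1:R) h d -> differentiable g q ->
  differentiable (fun y => h (g y)) q.
Proof.
move=> [hd _] hg; apply: (@differentiable_comp _ _ _ _ g h) => //.
exact/derivable1_diffP.
Qed.

Lemma difX f q n : differentiable f q -> differentiable (fun y => f y ^+ n) q.
Proof. by move=> hf; apply: (difO (h := fun x => x ^+ n) (derX n (derid (f q)))). Qed.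

Lemma difV f q : f q != 0 -> differentiable f q -> differentiable (fun y => (f y)^-1) q.
Proof. by move=> h hf; apply: (difO (h := fun x => x^-1) (derV h (derid (f q)))). Qed.

Lemma der_line f q w : differentiable f q ->
  is_derive (0:R) (1:R) (fun h : R => f (h *: w + q)) ('d f q w).
Proof.
move=> hf; rewrite -deriveE //.
have [hd] : is_derive q w f ('D_w f q) by apply/derivableP; exact: diff_derivable.
move=> _; have := hd; rewrite derivable1P => hd'.
have e := derivableP hd'.
by rewrite (derive_line e).
Qed.

Section stage.
Variables (a : nat) (x0 : R) (s p E : V -> R) (q : V).
Hypothesis x0n : a != 0%N -> x0 != 0.
Hypothesis ds : differentiable s q.
Hypothesis dp : differentiable p q.
Hypothesis dE : differentiable E q.
Hypothesis E0 : 0 < E q.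

Lemma dif_level_energy : differentiable (fun y => level_energy a x0 (p y) (E y)) q.
Proof. exact: (difD (difX 2 dp) (difM (difC (x0 ^+ (2 * a)) q) dE)). Qed.

Lemma dif_stage : [/\ differentiable (fun y => orbit_x a x0 (s y) (p y) (E y)) q,
  differentiable (fun y => orbit_p a x0 (s y) (p y) (E y)) q &
  differentiable (fun y => orbit_clock a x0 (s y) (p y) (E y)) q].
Proof.
have nE : E q != 0 := lt0r_neq0 E0.
have n1 : (1 + a)%:R != 0 :> R by rewrite pnatr_eq0.
have [hX hP] : differentiable (fun y => orbit_x a x0 (s y) (p y) (E y)) q /\
  differentiable (fun y => orbit_p a x0 (s y) (p y) (E y)) q; last first.
  split; [exact: hX|exact: hP|].
  have nn : (fun y => (1 + a)%:R * E y) q != 0 by rewrite mulf_neq0.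
  exact: (difM (difB (difM dif_level_energy ds) (difB (difM hX hP) (difM (difC x0 q) dp)))
    (difV nn (difM (difC (1 + a)%:R q) dE))).
rewrite /orbit_x /orbit_p; case: eqP => [_|/eqP an].
  by split; [exact: (difD (difC x0 q) (difM dp ds))|exact: dp].
have a0 : (0 < a)%N by rewrite lt0n.
have hv : differentiable (fun y => speed a x0 (p y) (E y)) q.
  exact: (difO (g := fun y => level_energy a x0 (p y) (E y)) (is_derive1_sqrt (level_energy_gt0
    x0n a0 (p q) E0)) dif_level_energy).
have nv : (fun y => speed a x0 (p y) (E y)) q != 0 := lt0r_neq0 (speed_gt0 x0n a0 (p q) E0).
have hph : differentiable (fun y => phase a x0 (p y) (E y)) q.
  have [_ _ h3] := gacosP a0 (ratio_itv x0n a0 (p q) E0).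
  exact: (difM (difC (Num.sg x0) q) (difO (g := fun y =>
    p y / speed a x0 (p y) (E y)) h3 (difM dp (difV nv hv)))).
have hsn := difO (g := fun y => phase a x0 (p y) (E y)) (der_gsin a0 _) hph.
have harg : differentiable (fun y => angle a x0 (s y) (p y) (E y)) q.
  exact: (difD (difM (difM (difM hv hsn) (difC x0^-1 q)) ds) hph).
have hs2 := difO (g := fun y => angle a x0 (s y) (p y) (E y)) (der_gsin a0 _) harg.
have hc2 := difO (g := fun y => angle a x0 (s y) (p y) (E y)) (der_gcos a0 _) harg.
have nph : (fun y => gsin a (phase a x0 (p y) (E y))) q != 0 := sn_phase_neq0 x0n a0 (p q) E0.
split; first exact: (difM (difM (difC x0 q) hs2) (difV nph hsn)).
exact: (difM hv hc2).
Qed.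

End stage.
End pointwise_differentiability.

Section exponential_map.
Variables (R : realType) (n : nat) (al : nat -> nat) (x0 : nat -> R).
Hypothesis alN : al n = 0%N.
Hypothesis x0n : forall k, (k < n)%N -> al k != 0%N -> x0 k != 0.
Local Notation V := ('rV[R]_n.+1).
Variable q : V.
Hypothesis qn : coords q n != 0.

Lemma dif_coords k : differentiable (fun y : V => coords y k) q.
Proof. exact: differentiable_coord. Qed.

Lemma dif_energy k : (k <= n.+1)%N -> differentiable (fun y : V => energy n al x0 (coords y) k) q.
Proof.
rewrite leq_eqVlt => /orP[/eqP->|].
  have -> : (fun y : V => energy n al x0 (coords y) n.+1) = (fun=> 0) by apply/funext => y;
    rewrite energy_end.
  exact: difC.
have step j : (j <= n)%N -> differentiable (fun y : V => energy n al x0 (coords y) j.+1) q ->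
    differentiable (fun y : V => energy n al x0 (coords y) j) q.
  move=> jn ih.
  have -> : (fun y : V => energy n al x0 (coords y) j) =
    (fun y => level_energy (al j) (x0 j) (coords y j) (energy n al x0 (coords y) j.+1)).
    by apply/funext => y; rewrite (@energyS R n al x0 (coords y) j jn).
  exact: (dif_level_energy (al j) (x0 j) (dif_coords j) ih).
move: k; apply: energy_down.
  apply: step => //.
  have -> : (fun y : V => energy n al x0 (coords y) n.+1) = (fun=> 0) by apply/funext => y;
    rewrite energy_end.
  exact: difC.
by move=> k kn; apply: step; exact: ltnW.
Qed.

Lemma dif_clock t k : (k <= n)%N -> differentiable (fun y : V => clock n al x0 t (coords y) k) q.
Proof.
elim: k => [|k ih] kn; first exact: difC.
have E0 : 0 < energy n al x0 (coords q) k.+1 by apply: (energy_gt0 qn x0n).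
by have [_ _] := dif_stage (x0n kn) (ih (ltnW kn)) (dif_coords k) (dif_energy (leqW kn)) E0.
Qed.

Lemma dif_flow_x t k : (k <= n)%N -> differentiable (fun y : V => flow_x n al x0 t (coords y) k) q.
Proof.
rewrite leq_eqVlt => /orP[/eqP->|kn].
  have -> : (fun y : V => flow_x n al x0 t (coords y) n) = (fun y =>
    x0 n + coords y n * clock n al x0 t (coords y) n).
    by apply/funext => y; rewrite flow_x_last.
  exact: (difD (difC (x0 n) q) (difM (dif_coords n) (dif_clock t (leqnn n)))).
have E0 : 0 < energy n al x0 (coords q) k.+1 by apply: (energy_gt0 qn x0n).
by have [] := dif_stage (x0n kn) (dif_clock t (ltnW kn)) (dif_coords k) (dif_energy (leqW kn)) E0.
Qed.

End exponential_map.

(** The exponential map is known explicitly only on the open set where the last momentum is nonzero,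
    so differentials have to be transported along local equality. *)
Lemma near_eq_diff (R : realType) (V W : normedModType R) (f g : V -> W) (x : V) :
  (\forall y \near x, f y = g y) -> differentiable g x ->
  differentiable f x /\ 'd f x = 'd g x :> (V -> W).
Proof.
move=> fg dg; have fx : f x = g x := nbhs_singleton fg.
have cg : continuous ('d g x) by exact: diff_continuous.
have h : f \o shift x = cst (f x) + 'd g x +o_ 0 id.
  apply/eqaddoP => _/posnumP[e].
  have /eqaddoP /(_ e%:num (gt0 e)) hg := diff_locally dg.
  have fg0 : \forall y \near 0, f (y + x) = g (y + x).
    by move: fg; rewrite (near_shift 0 x) /= subr0; apply: filterS.
  apply: filterS2 fg0 hg => y e1; rewrite !fctE /= e1 fx; exact.
have e : 'd f x = 'd g x :> (V -> W) by exact: diff_unique cg h.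
split; [apply/diff_locallyP; rewrite e; split; [exact: cg|exact: h]|exact: e].
Qed.

(** * Linear algebra of the triangular system satisfied by a variation *)

Section jacobi_fields.
Variables (R : realFieldType) (n : nat) (E T P kp p c : nat -> R).
Hypothesis En : forall k, (k < n)%N -> E k.+1 != 0.
Hypothesis cn : forall k, (k < n)%N -> c k != 0.
Hypothesis T0 : T 0%N != 0.
Hypothesis pn : p n != 0.
Hypothesis Pn : P n = p n.

Variables dE dT dX w : nat -> R.
Local Notation B k := (E k * dT k + T k * dE k / 2).
Hypothesis dT0 : dT 0%N = 0.
Hypothesis var_energy : forall k, (k < n)%N -> dE k = 2 * p k * w k + c k * dE k.+1.
Hypothesis var_action : forall k, (k < n)%N -> P k * dX k = B k - B k.+1.
Hypothesis var_conjugate : forall k, (k < n)%N -> dE k = 0 -> dT k = 0 -> dX k = kp k * w k.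
Hypothesis var_last : dE n = 2 * p n * w n /\ p n * dX n = B n.

(** The level identities telescope from the last level down. At k = 0, where dT 0 = 0, the pairing
    of P with dX is T 0 * dE 0 / 2; as T 0 is nonzero it vanishes exactly when dE 0 does. *)
Lemma action_sum k : (k <= n)%N ->
  \sum_(j < n.+1) P j * dX j = \sum_(j < k) P j * dX j + B k.
Proof.
move: k; apply: energy_down; first by rewrite big_ord_recr /= Pn var_last.2.
by move=> k kn ->; rewrite big_ord_recr /= (var_action kn) -addrA subrK.
Qed.

(** Vanishing spreads upward: dE k = dT k = 0 gives dX k = kp k * w k, so w k = 0; then [var_energy]
    gives dE (k+1) = 0, and [var_action] gives dT (k+1) = 0 because E (k+1) is nonzero. *)
Lemma variation_prefix j : (j <= n)%N -> \sum_(j < n.+1) P j * dX j = 0 ->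
  (forall k, (k < j)%N -> dX k = 0 /\ kp k != 0) ->
  forall k, (k <= j)%N -> (dE k = 0 /\ dT k = 0) /\ (forall i, (i < k)%N -> w i = 0).
Proof.
move=> jn S0 hk; elim=> [|k ih] kj.
  split => //; split => //.
  have /eqP := action_sum (leq0n n); rewrite S0 big_ord0 dT0 mulr0 !add0r eq_sym.
  by rewrite mulf_eq0 invr_eq0 pnatr_eq0 orbF mulf_eq0 (negbTE T0) /= => /eqP.
have [[E0 dTk] w0] := ih (ltnW kj); have [X0 kn] := hk k kj.
have kjn := leq_trans kj jn.
have wk : w k = 0.
  have /eqP := var_conjugate kjn E0 dTk.
  by rewrite X0 eq_sym mulf_eq0 (negbTE kn) /= => /eqP.
have Ek1 : dE k.+1 = 0.
  have /eqP := var_energy kjn.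
  by rewrite E0 wk mulr0 add0r eq_sym mulf_eq0 (negbTE (cn kjn)) /= => /eqP.
split; last by move=> i; rewrite ltnS leq_eqVlt => /orP[/eqP->|/w0].
split => //; have /eqP := var_action kjn.
rewrite X0 mulr0 E0 dTk Ek1 !mulr0 mul0r !addr0 sub0r eq_sym.
by rewrite oppr_eq0 mulf_eq0 (negbTE (En kjn)) /= => /eqP.
Qed.

Lemma trivial_kernel : (forall k, (k < n)%N -> kp k != 0) -> (forall k, (k <= n)%N -> dX k = 0) ->
  forall k, (k <= n)%N -> w k = 0.
Proof.
move=> kpn X0.
have S0 : \sum_(j < n.+1) P j * dX j = 0 by apply: big1 => j _; rewrite X0 ?mulr0 // -ltnS.
have [[dEn _] wk] := variation_prefix (leqnn n) S0 (fun k kn =>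
  conj (X0 k (ltnW kn)) (kpn k kn)) (leqnn n).
move=> k; rewrite leq_eqVlt => /orP[/eqP->|]; last exact: wk.
have /eqP := var_last.1.
by rewrite dEn eq_sym mulf_eq0 mulf_eq0 pnatr_eq0 (negbTE pn) /= => /eqP.
Qed.

(* At the first conjugate level [j], the variations with [dX i = 0] for [i < j] and no
   first-order change of length do not move [X j]. *)
Lemma unreachable j : (j < n)%N -> kp j = 0 -> (forall k, (k < j)%N -> kp k != 0) ->
  ~ (forall k, (k <= n)%N -> dX k = (k == j)%:R - P j / p n * (k == n)%:R).
Proof.
move=> jn kpj kpk Xw.
have S0 : \sum_(i < n.+1) P i * dX i = 0.
  rewrite big_ord_recr /= Xw // eqxx (gtn_eqF jn).
  rewrite (bigD1 (Ordinal jn)) //= Xw ?(ltnW jn) // eqxx (ltn_eqF jn).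
  rewrite big1 => [|i ij]; first by rewrite Pn [true%:R]mulr1n [false%:R]mulr0n; field.
  have ijn : (nat_of_ord i == j) = false by apply/eqP => e; move/eqP: ij; apply; apply: val_inj.
  by rewrite Xw ?(ltnW (ltn_ord i)) // ijn (ltn_eqF (ltn_ord i)) mulr0 subrr mulr0.
have pre k : (k < j)%N -> dX k = 0 /\ kp k != 0.
  move=> kj; split; last exact: kpk.
  by rewrite Xw ?(ltnW (ltn_trans kj jn)) // (ltn_eqF kj) (ltn_eqF (ltn_trans kj jn)) mulr0 subrr.
have [[Ej Tj] _] := variation_prefix (ltnW jn) S0 pre (leqnn j).
have /eqP := var_conjugate jn Ej Tj.
by rewrite kpj mul0r Xw ?(ltnW jn) // eqxx (ltn_eqF jn) mulr0 subr0 oner_eq0.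
Qed.

End jacobi_fields.

(** * When the Jacobian of the explicit map is singular *)

Section criterion.
Variables (R : realType) (n : nat) (al : nat -> nat) (x0 : nat -> R).
Hypothesis alN : al n = 0%N.
Hypothesis x0n : forall k, (k < n)%N -> al k != 0%N -> x0 k != 0.
Local Notation V := ('rV[R]_n.+1).
Variable q : V.
Hypothesis qn : coords q n != 0.
Variable t : R.

Local Notation E k := (fun y : V => energy n al x0 (coords y) k).
Local Notation T k := (fun y : V => clock n al x0 t (coords y) k).
Local Notation X k := (fun y : V => flow_x n al x0 t (coords y) k).
Local Notation P k := (flow_p n al x0 t (coords q) k).
Local Notation B k w := (E k q * 'd (T k) q w + T k q * 'd (E k) q w / 2).
Local Notation kp k := (conj_coef (al k) (x0 k) (T k q) (coords q k) (E k.+1 q)).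

Let line0 (w : V) : (0 : R) *: w + q = q. Proof. by rewrite scale0r add0r. Qed.

Lemma der_coords w k : is_derive (0:R) (1:R) (fun h : R => coords (h *: w + q) k) (coords w k).
Proof.
have -> : (fun h : R => coords (h *: w + q) k) = (fun h => h * coords w k + coords q k).
  by apply/funext => h; rewrite /coords !mxE.
apply: (der_eq (derD (derM (derid (0:R)) (derC (coords w k) 0)) (derC (coords q k) 0))).
by rewrite mul1r mul0r !addr0.
Qed.

Let Egt0 k : (k < n)%N -> 0 < E k.+1 q.
Proof. by move=> kn; apply: (energy_gt0 qn x0n). Qed.

Lemma variation w k : (k < n)%N ->
  [/\ 'd (E k) q w = 2 * coords q k * coords w k + x0 k ^+ (2 * al k) * 'd (E k.+1) q w,
      P k * 'd (X k) q w = B k w - B k.+1 w &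
      'd (E k) q w = 0 -> 'd (T k) q w = 0 -> 'd (X k) q w = kp k * coords w k].
Proof.
move=> kn.
have hs := der_line w (dif_clock x0n qn t (ltnW kn)).
have hE := der_line w (dif_energy al x0 q (leqW kn)).
have hE0 := der_line w (dif_energy al x0 q (leqW (ltnW kn))).
have hp := der_coords w k.
have hX := der_line w (dif_flow_x alN x0n qn t (ltnW kn)).
have hT := der_line w (dif_clock x0n qn t kn).
have EL : 0 < (fun h : R => energy n al x0 (coords (h *: w + q)) k.+1) 0 by rewrite /= line0;
  exact: Egt0.
have [dX [dP [dT [[h1 _ h3] [e1 e2 _]]]]] := stage_derivative (x0n kn) hs hp hE EL.
have EE : 'd (E k) q w = 2 * coords q k * coords w k + x0 k ^+ (2 * al k) * 'd (E k.+1) q w.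
  have := der_level_energy (al k) (x0 k) hp hE; rewrite /d_level_energy line0 => h4.
  apply: der_unique hE0 _; move: h4; congr (is_derive _ _ _ _); apply/funext => h.
  by rewrite (@energyS R n al x0 _ k (ltnW kn)).
have eX := der_unique h1 hX; have eT := der_unique h3 hT.
rewrite /d_level_energy /= line0 in e1 e2; rewrite -EE in e1 e2; rewrite eX eT in e1;
  rewrite eX in e2.
split; [exact: EE| |exact: e2].
by rewrite /flow_p e1 -(@energyS R n al x0 (coords q) k (ltnW kn)) -addrA -opprD -clockS.
Qed.

Lemma variation_last w :
  'd (E n) q w = 2 * coords q n * coords w n /\ coords q n * 'd (X n) q w = B n w.
Proof.
have hE := der_line w (dif_energy al x0 q (leqW (leqnn n))).
have hs := der_line w (dif_clock x0n qn t (leqnn n)).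
have hX := der_line w (dif_flow_x alN x0n qn t (leqnn n)).
have hp := der_coords w n.
have EE : 'd (E n) q w = 2 * coords q n * coords w n.
  apply: der_unique hE _.
  have -> : (fun h : R => energy n al x0 (coords (h *: w + q)) n) = (fun h =>
    coords (h *: w + q) n ^+ 2).
    by apply/funext => h; rewrite energy_last.
  by apply: (der_eq (derX 2 hp)); rewrite line0 expr1.
split => //.
have -> : 'd (X n) q w = coords w n * T n q + coords q n * 'd (T n) q w.
  apply: der_unique hX _.
  have -> : (fun h : R => flow_x n al x0 t (coords (h *: w + q)) n) =
    (fun h => x0 n + coords (h *: w + q) n * clock n al x0 t (coords (h *: w + q)) n).
    by apply/funext => h; rewrite flow_x_last.
  by apply: (der_eq (derD (derC (x0 n) 0) (derM hp hs))); rewrite line0 add0r.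
by rewrite EE energy_last; field.
Qed.

Lemma variation0 w : 'd (T 0) q w = 0.
Proof.
have := der_line w (dif_clock x0n qn t (leq0n n)).
by move=> h; apply: der_unique h _; exact: derC.
Qed.

Definition xmap (y : V) : V := \row_j flow_x n al x0 t (coords y) j.

Lemma dif_xmap : differentiable xmap q.
Proof.
have -> : xmap = \sum_(j < n.+1) (fun y => X j y *: delta_mx ord0 j).
  apply/funext => y; rewrite fct_sumE /xmap; apply/rowP => j; rewrite mxE summxE.
  rewrite (bigD1 j) //= big1 ?addr0 => [|i ij]; rewrite !mxE eqxx /=.
    by rewrite mulr1.
  by rewrite eq_sym (negbTE ij) mulr0.
apply: differentiable_sum => j; apply: differentiableZl.
by apply: dif_flow_x => //; rewrite -ltnS.
Qed.

Lemma diff_xmap w (j : 'I_n.+1) : ('d xmap q w) ord0 j = 'd (X j) q w.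
Proof.
have jn : (j <= n)%N by rewrite -ltnS.
rewrite -(deriveE w dif_xmap) derive_mx; last exact: diff_derivable dif_xmap.
rewrite mxE -(deriveE w (dif_flow_x alN x0n qn t jn)).
by congr ('D_w _ q); apply/funext => y; rewrite mxE.
Qed.

Hypothesis tn : t != 0.

Lemma coordsP (w : V) : (forall k, (k <= n)%N -> coords w k = 0) -> w = 0.
Proof. by move=> h; apply/rowP => j; rewrite mxE -coords_ord h // -ltnS. Qed.

(** One direction tests injectivity, the other surjectivity: with no vanishing coefficient the
    kernel is trivial, while at the first vanishing coefficient an explicit vector is missed by the
    image. *)
Lemma critical_conj_coef : \det (jacobian xmap q) = 0 <-> exists2 k, (k < n)%N & kp k = 0.
Proof.
have dJ w : w *m jacobian xmap q = 'd xmap q w by rewrite /jacobian mul_rV_lin1.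
have En k : (k < n)%N -> E k.+1 q != 0 by move=> kn; apply: lt0r_neq0; exact: Egt0.
have cn k : (k < n)%N -> x0 k ^+ (2 * al k) != 0.
  by move=> kn; apply: lt0r_neq0; apply: exprXX_gt0; exact: x0n.
have Pn : flow_p n al x0 t (coords q) n = coords q n by apply: flow_p_last.
have V1 w k (kn : (k < n)%N) := let: And3 h _ _ := variation w kn in h.
have V2 w k (kn : (k < n)%N) := let: And3 _ h _ := variation w kn in h.
have V3 w k (kn : (k < n)%N) := let: And3 _ _ h := variation w kn in h.
split=> [/eqP/det0P[w wn wJ]|].
  apply: contrapT => hk; move/negP: wn; apply; apply/eqP/coordsP.
  apply: (trivial_kernel En cn tn qn Pn (variation0 w) (V1 w) (V2 w) (V3 w) (variation_last w)).
    by move=> k kn; apply/eqP => h; apply: hk; exists k.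
  move=> k; rewrite -ltnS => kn; have := diff_xmap w (Ordinal kn).
  by rewrite -dJ wJ mxE => /esym.
case=> k0 kn0 kp0; apply/eqP; apply/negPn/negP => detn.
have ex : exists k, (k < n)%N && (kp k == 0) by exists k0; rewrite kn0 kp0 eqxx.
have [j /andP[jn /eqP kpj] jmin] := ex_minnP ex.
have jn1 : (j < n.+1)%N by exact: leqW.
(* Chosen orthogonal to the final momentum, whose last entry is [coords q n], so that a preimage
   would preserve the length to first order. *)
pose target : V := delta_mx ord0 (Ordinal jn1) - (P j / coords q n) *: delta_mx ord0 ord_max.
pose w := target *m invmx (jacobian xmap q).
have uJ : jacobian xmap q \in unitmx by rewrite unitmxE unitfE.
have wJ : 'd xmap q w = target by rewrite -dJ /w mulmxKV.
have kpk k : (k < j)%N -> kp k != 0.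
  move=> kj; apply/eqP => h; have := jmin k.
  by rewrite (ltn_trans kj jn) h eqxx leqNgt kj => /(_ isT).
refine (@unreachable R n (fun k => E k q) (fun k => T k q) (fun k => P k) (fun k => kp k) (coords q)
  (fun k => x0 k ^+ (2 * al k)) En cn tn qn Pn _ _ _ _ (variation0 w) (V1 w) (V2 w) (V3 w)
  (variation_last w) j jn kpj kpk _).
move=> k; rewrite -ltnS => kn; rewrite -(diff_xmap w (Ordinal kn)) wJ !mxE eqxx.
by rewrite -!val_eqE.
Qed.

End criterion.

(** * Comparison of first times *)

(** The condition t > 0 is not closed; the uniform bound [e] keeps the infimum away from 0, and
    continuity then places it in the set. *)
Lemma zero_set_min (R : realType) (F : R -> R) (A : set R) (e : R) :
  (forall t, {for t, continuous F}) -> 0 < e -> (forall t, A t <-> 0 < t /\ F t = 0) ->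
  (forall t, A t -> e <= t) -> A !=set0 ->
  exists2 t0, A t0 & ereal_inf (EFin @` A) = t0%:E.
Proof.
move=> cF e0 AE Ae A0.
have Alb : has_lbound A by exists e.
have hA : has_inf A by split.
have infe : e <= inf A by apply: lb_le_inf.
have Am : A (inf A).
  apply/AE; split; first exact: lt_le_trans infe.
  apply: contrapT => /eqP F0.
  have : \forall t \near inf A, F t != 0 by exact: (cvgr_neq0 (F (inf A))) (cF (inf A)) F0.
  move=> /nbhs_ballP[d /= d0 hd].
  have [t At tl] := inf_adherent d0 hA.
  have bt : ball (inf A) d t.
    by rewrite /ball/= ltr_norml; have h := ge_inf Alb At; apply/andP; split; lra.
  by have [_ Ft] := (AE t).1 At; have := hd t bt; rewrite Ft eqxx.
exists (inf A) => //; apply/eqP; rewrite eq_le; apply/andP; split.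
  by apply: ereal_inf_lbound; exists (inf A).
by apply: le_ereal_inf_tmp => _ [t At <-]; rewrite lee_fin; exact: ge_inf.
Qed.

Section first_times.
Variables (R : realType) (I : finType) (J : pred I).
Variables (u : I -> R -> R) (c : I -> R) (Z : I -> R -> R) (good : I -> Prop).
Hypothesis cu : forall j t, J j -> {for t, continuous (u j)}.
Hypothesis cZ : forall j t, J j -> {for t, continuous (Z j)}.
Hypothesis u0 : forall j, J j -> u j 0 = 0.
Hypothesis u_gt0 : forall j t, J j -> 0 < t -> 0 < u j t.
Hypothesis c_gt0 : forall j, J j -> 0 < c j.
Hypothesis Z_le : forall j x, J j -> 0 < x -> Z j x = 0 -> c j <= x /\ (x = c j -> good j).
Hypothesis Z_c : forall j, J j -> good j -> Z j (c j) = 0.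
Hypothesis hit : exists j t, [/\ J j, 0 < t & u j t = c j].

Let A j : set R := [set t | 0 < t /\ u j t = c j].
Let C : set R := [set t | 0 < t /\ exists2 j, J j & Z j (u j t) = 0].
Let tj j := ereal_inf (EFin @` A j).
Let tau := ereal_inf (tj @` [set j | J j]).
Let tc := ereal_inf (EFin @` C).

Lemma first_times_bound : exists2 e : R, 0 < e & forall j t, J j -> 0 < t < e -> u j t < c j.
Proof.
have near_j j : \forall t \near (0:R), J j ==> (u j t < c j).
  have [Jj|_] := boolP (J j); last by near=> t.
  have : \forall t \near (0:R), u j t < c j.
    have lt0 : u j 0 < c j by rewrite u0 // c_gt0.
    by move/cvgr_lt: (@cu j 0 Jj); apply.
  by apply: filterS => t ->; rewrite implybT.
have := @filter_forall R I (fun j t => J j ==> (u j t < c j)) (nbhs (0:R)) (nbhs_filter (0:R))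
  near_j.
move=> /nbhs_ballP[e /= e0 he]; exists e => // j t Jj /andP[t0 te].
have := he t _ j; rewrite Jj /=; apply.
by rewrite /ball/= sub0r normrN gtr0_norm.
Unshelve. all: end_near. Qed.

Lemma first_times_reach j t : J j -> 0 < t -> c j <= u j t -> exists2 t', A j t' & t' <= t.
Proof.
move=> Jj t0 ct; have cw : {within `[0, t], continuous (u j)}.
  by apply: continuous_subspaceT => x; exact: cu.
have [|t' /[!in_itv]/= /andP[t'0 t't] e] := @IVT R (u j) 0 t (c j) (ltW t0) cw.
  by rewrite u0 // ge_min le_max (ltW (c_gt0 Jj)) ct orbT.
exists t' => //; split => //; rewrite lt_neqAle t'0 andbT; apply/eqP => t'e.
by move: e; rewrite -t'e u0 // => e; have := c_gt0 Jj; rewrite -e ltxx.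
Qed.

Lemma tau_le j t : J j -> A j t -> (tau <= t%:E)%E.
Proof.
move=> Jj At; apply: (@le_trans _ _ (tj j)); first by apply: ereal_inf_lbound; exists j.
by apply: ereal_inf_lbound; exists t.
Qed.

Lemma crit_reach t : C t -> exists j t', [/\ J j, A j t', t' <= t, Z j (u j t) = 0 & c j <= u j t].
Proof.
move=> [t0 [j Jj Zj]]; have [cl _] := Z_le Jj (u_gt0 Jj t0) Zj.
by have [t' At' t't] := first_times_reach Jj t0 cl; exists j, t'.
Qed.

(** A zero of [Z j] forces [u j] to be at least [c j], so by the intermediate value theorem the
    threshold was met no later: this bounds [tau] by [tc]. Finiteness of [tau], from [hit], ensures
    that an equality happens at an actual time, where [u j] equals [c j] exactly. *)
Lemma first_times_compare :
  [/\ (0 < tau)%E, (tau <= tc)%E &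
   (tau = tc <-> exists j, [/\ J j, tau = tj j & good j])].
Proof.
have [e e0 he] := first_times_bound.
have Ae j t : J j -> A j t -> e <= t.
  move=> Jj [t0 ut]; rewrite leNgt; apply/negP => te.
  by have := he j t Jj; rewrite t0 te ut ltxx => /(_ isT).
have Ce t : C t -> e <= t.
  by move=> /crit_reach[j [t' [Jj At' t't _ _]]]; apply: le_trans t't; exact: Ae At'.
have tau0 : (0 < tau)%E.
  apply: (@lt_le_trans _ _ e%:E); first by rewrite lte_fin.
  by apply: le_ereal_inf_tmp => _ [j Jj <-]; apply: le_ereal_inf_tmp => _ [t At <-];
    rewrite lee_fin; exact: Ae At.
have tau_tc : (tau <= tc)%E.
  apply: le_ereal_inf_tmp => _ [t Ct <-]; have [j [t' [Jj At' t't _ _]]] := crit_reach Ct.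
  by apply: le_trans (tau_le Jj At') _; rewrite lee_fin.
have tau_fin : (tau < +oo)%E.
  by have [j [t [Jj t0 ut]]] := hit; apply: le_lt_trans (tau_le Jj _) (ltry t).
split => //; split=> [tautc|[j [Jj tauj gj]]].
- have C0 : C !=set0.
    apply/set0P/eqP => C0; move: tau_fin; rewrite tautc /tc C0 image_set0 ereal_inf0.
    by rewrite ltxx.
  (* Critical times are the positive zeros of this single continuous function, so the first one is
     attained. *)
  pose F t := \prod_(j | J j) Z j (u j t).
  have cF t : {for t, continuous F}.
    have -> : F = (fun t => \prod_(j <- enum J) Z j (u j t)).
      by apply/funext => x; rewrite /F big_enum.
    have : all J (enum J) by apply/allP => x; rewrite mem_enum.
    elim: (enum J) => [_|j s ih /= /andP[Jj Js]].
      have -> : (fun t => \prod_(j <- [::]) Z j (u j t)) = (fun=> 1) by apply/funext => x;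
        rewrite big_nil.
      exact: cvg_cst.
    have -> : (fun t => \prod_(i <- j :: s) Z i (u i t)) =
      (fun t => Z j (u j t) * \prod_(i <- s) Z i (u i t)) by apply/funext => x; rewrite big_cons.
    apply: cvgM; last exact: ih.
    by apply: continuous_comp; [exact: cu|exact: cZ].
  have CE t : C t <-> 0 < t /\ F t = 0.
    split=> -[t0]; [move=> [j Jj Zj]|move=> /eqP Ft]; split => //.
      by rewrite /F (bigD1 j) //= Zj mul0r.
    move: Ft; rewrite /F prodf_seq_eq0 => /hasP[j _ /andP[Jj /eqP Zj]].
    by exists j.
  have [t0 Ct0 tcE] := zero_set_min cF e0 CE Ce C0.
  have [j [t' [Jj At' t't Zj cj]]] := crit_reach Ct0.
  have tauE : tau = t0%:E by rewrite tautc.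
  have t'E : t' = t0.
    by apply/eqP; rewrite eq_le t't; have := tau_le Jj At'; rewrite tauE lee_fin.
  exists j; split => //.
    apply/eqP; rewrite eq_le; apply/andP; split; first by apply: ereal_inf_lbound; exists j.
    by rewrite tauE -t'E; apply: ereal_inf_lbound; exists t'.
  have [_] := Z_le Jj (u_gt0 Jj Ct0.1) Zj; apply.
  by have [_ <-] := At'; rewrite t'E.
- have Aj0 : A j !=set0.
    apply/set0P/eqP => A0; move: tau_fin; rewrite tauj /tj A0 image_set0 ereal_inf0.
    by rewrite ltxx.
  have cF t : {for t, continuous (fun t => u j t - c j)}.
    by apply: cvgB; [exact: cu|exact: cvg_cst].
  have AE t : A j t <-> 0 < t /\ u j t - c j = 0.
    by split=> -[t0 h]; split => //; [rewrite h subrr|move/subr0_eq: h].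
  have [t0 At0 tjE] := zero_set_min cF e0 AE (fun t => @Ae j t Jj) Aj0.
  apply/eqP; rewrite eq_le tau_tc /= tauj /tj tjE; apply: ereal_inf_lbound.
  exists t0 => //; case: At0 => t00 ut0; split => //; exists j => //.
  by rewrite ut0; exact: Z_c.
Qed.

End first_times.

(** * Geodesics in spherical coordinates *)

(** At exponent 0 the coefficient is the clock T / t > 0, so only levels of J can be conjugate;
    elsewhere the scaling laws cancel t from phase and angle. *)
Lemma conj_coef_eq0 (R : realType) (a : nat) (x0 t T p E : R) : (a != 0%N -> x0 != 0) ->
  0 < t -> 0 < T -> 0 < E ->
  conj_coef a x0 (T / t) (t * p) (t ^+ 2 * E) = 0 <->
  a != 0%N /\ conj_fun a (phase a x0 p E) (freq a x0 p E * T) = 0.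
Proof.
move=> xn t0 T0 E0; have tn := lt0r_neq0 t0.
rewrite /conj_coef; case: (a =P 0%N) => [_|/eqP an].
  by split=> [/eqP|[//]]; rewrite mulf_eq0 invr_eq0 (negbTE tn) (gt_eqF T0).
have a0 : (0 < a)%N by rewrite lt0n.
have E0' : 0 < t ^+ 2 * E by rewrite mulr_gt0 // exprn_gt0.
have vn := lt0r_neq0 (speed_gt0 xn a0 (t * p) E0').
rewrite (freq_scale xn p a0 E0 t0) (phase_scale xn a0 p E0 t0).
have -> : t * freq a x0 p E * (T / t) = freq a x0 p E * T by field.
have sn := sn_phase_neq0 xn a0 p E0.
have dn : a%:R * speed a x0 (t * p) (t ^+ 2 * E) * gsin a (phase a x0 p E) ^+ (2 * a).+1 != 0.
  by rewrite mulf_neq0 ?expf_neq0 // mulf_neq0 // pnatr_eq0.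
split=> [/eqP|[_ ->]]; last by rewrite mulr0 mul0r.
rewrite mulf_eq0 invr_eq0 (negbTE dn) orbF mulf_eq0 oppr_eq0 (negbTE (xn an)) /= => /eqP.
by [].
Qed.

Section spherical_coordinates.
Variables (R : realType) (n : nat) (alpha : 'I_n -> nat) (x0 : 'rV[R]_n.+1) (phi : 'I_n -> R).
Hypothesis rx : riemannian alpha x0.
Hypothesis phi0 : Rcoord0 alpha phi.

Local Notation al := (alpha_seq alpha).
Local Notation X0 := (coords x0).
Local Notation p := (coords (p0phi alpha x0 phi)).
Local Notation gd := (gdelta alpha x0 phi).
Local Notation E := (energy n al X0 p).
Local Notation ta := (talpha alpha).

Definition gprod (k : nat) : R := \prod_(i < n | (i < k)%N) gd i.

Lemma x0_riemannian k : (k < n)%N -> al k != 0%N -> X0 k != 0.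
Proof. by move=> kn; have := rx (j := Ordinal kn); rewrite -alpha_seq_ord -coords_widx. Qed.

Lemma talpha_gt0 (k : 'I_n) : (0 < ta k)%N.
Proof. by rewrite /talpha; case: (alpha k =P 0%N) => // /eqP; rewrite lt0n. Qed.

Lemma tx_neq0 (k : 'I_n) : tx alpha x0 k != 0.
Proof. by rewrite /tx; case: (alpha k =P 0%N) => [_|/eqP h]; [rewrite oner_eq0|exact: rx]. Qed.

Lemma gdelta_neq0 (k : 'I_n) : gd k != 0.
Proof.
have s0 := phi0.2 k; rewrite /gdelta /grho mulf_neq0 ?expf_neq0 ?normr_eq0 //;
  by rewrite mulf_neq0 // invr_eq0 tx_neq0.
Qed.

Lemma gprod_neq0 k : gprod k != 0.
Proof. by rewrite /gprod prodf_seq_neq0; apply/allP => i _; rewrite gdelta_neq0 implybT. Qed.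

Lemma gprodS (k : 'I_n) : gprod k.+1 = gprod k * gd k.
Proof.
rewrite /gprod (bigD1 k) //= mulrC; congr (_ * _); apply: eq_bigl => i.
by rewrite ltnS [in RHS]ltn_neqAle andbC.
Qed.

Lemma p0_coord (k : 'I_n) : p k = gcos (ta k) (phi k) * gprod k.
Proof. by rewrite coords_widx mxE /= (valK k). Qed.

Lemma p0_last : p n = gprod n.
Proof.
rewrite /coords mxE inordK // insubF ?ltnn //; apply: eq_bigl => i.
by rewrite ltn_ord.
Qed.

Lemma p0_last_neq0 : p n != 0.
Proof. by rewrite p0_last gprod_neq0. Qed.

Lemma gdelta_sqr (k : 'I_n) : X0 k ^+ (2 * al k) * gd k ^+ 2 = gsin (ta k) (phi k) ^+ (2 * ta k).
Proof.
have t0 := talpha_gt0 k.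
have -> : gd k ^+ 2 = (gsin (ta k) (phi k) / tx alpha x0 k) ^+ (2 * ta k).
  rewrite /gdelta /grho; set y := _ / _; rewrite exprMn -exprM mulnC exprM real_normK ?num_real //.
  by rewrite -exprSr exprM; congr (_ ^+ _); lia.
rewrite alpha_seq_ord expr_div_n /talpha /tx; case: (alpha k =P 0%N) => [->|/eqP h].
  by rewrite muln0 expr0 mul1r expr1n divr1.
by rewrite coords_widx mulrC divfK // expf_neq0 // rx.
Qed.

(** The coordinates are built for this: by [gdelta_sqr] each step down adds cos_a^2 and sin_a^(2a)
    with the same factor. At k = 0 the product is empty, which is the normalization to unit
    speed. *)
Lemma energy_gprod k : (k <= n)%N -> E k = gprod k ^+ 2.
Proof.
move: k; apply: energy_down; first by rewrite energy_last p0_last.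
move=> k kn ih; rewrite (@energyS R n al X0 p k (ltnW kn)) ih /level_energy.
have := p0_coord (Ordinal kn) => /= ->; have := gprodS (Ordinal kn) => /= ->.
have d2 := gdelta_sqr (Ordinal kn); rewrite /= in d2.
rewrite [X in _ + _ * X]exprMn mulrCA d2 exprMn mulrC -mulrDr.
by rewrite gcos_gsin ?mulr1 // talpha_gt0.
Qed.

Lemma energy_pos k : (k < n)%N -> 0 < E k.+1.
Proof. by move=> kn; rewrite energy_gprod // exprn_even_gt0 //= gprod_neq0. Qed.

Section level.
Variable j : 'I_n.
Hypothesis aj : alpha j != 0%N.
Local Notation a := (alpha j).
Local Notation ph := (phase a (X0 j) (p j) (E j.+1)).

Let a0 : (0 < a)%N. Proof. by rewrite lt0n. Qed.
Let xj : a != 0%N -> X0 j != 0. Proof. by rewrite -alpha_seq_ord; exact: x0_riemannian. Qed.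
Let Ej : 0 < E j.+1 := energy_pos (ltn_ord j).
Let taj : ta j = a. Proof. by rewrite /talpha (negbTE aj). Qed.

Lemma speed_gprod : speed a (X0 j) (p j) (E j.+1) = `|gprod j|.
Proof.
rewrite /speed -{1}alpha_seq_ord -(@energyS R n al X0 p j (ltnW (ltn_ord j))) energy_gprod
  ?sqrtr_sqr //.
exact: ltnW.
Qed.

Lemma cs_phase_gprod : gcos a ph = gcos a (phi j) * (gprod j / `|gprod j|).
Proof. by rewrite (cs_phase xj a0 (p j) Ej) speed_gprod p0_coord taj mulrA. Qed.

(** By [cs_phase_gprod] the cosines of phase and phi_j agree up to sign, so the 2a-th powers of
    their sines agree, and hence so do the absolute values. *)
Lemma freq_gomega : freq a (X0 j) (p j) (E j.+1) = `|gomega alpha x0 phi j|.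
Proof.
have f0 := freq_gt0 xj a0 (p j) Ej.
have nq (x y z : R) : `|x * y / z| = `|x| * `|y| / `|z| by rewrite !normrM normfV.
have nr (x y z : R) : `|x / y * z| = `|z| * `|x| / `|y| by rewrite !normrM normfV; ring.
rewrite -[LHS](ger0_norm (ltW f0)) /freq nq speed_gprod normr_id.
rewrite /gomega -/(gprod j) nr -coords_widx.
suff -> : `|gsin a ph| = `|gsin a (phi j)| by [].
apply/eqP; rewrite -(@eqrXn2 _ (2 * a)) ?normr_ge0 ?muln_gt0 //.
have n2 (x : R) : `|x| ^+ (2 * a) = x ^+ (2 * a) by rewrite !exprM real_normK ?num_real.
rewrite !n2.
have h1 := gcos_gsin a0 ph; have h2 := gcos_gsin a0 (phi j).
have h3 : gcos a ph ^+ 2 = gcos a (phi j) ^+ 2.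
  rewrite cs_phase_gprod exprMn expr_div_n real_normK ?num_real // divff ?mulr1 //.
  by rewrite expf_neq0 // gprod_neq0.
by apply/eqP; rewrite h3 in h1; lra.
Qed.

Lemma gomega_gt0 : 0 < `|gomega alpha x0 phi j|.
Proof. by rewrite -freq_gomega; exact: freq_gt0. Qed.

Lemma phi_range : 0 <= phi j < 2 * gpi R a.
Proof.
have := phi0.1 j; rewrite taj; case: ifP => // _ /andP[-> h] /=.
by have := gpi_gt0 R a0 => q; lra.
Qed.

Lemma cs_phase_eq0 : gcos a ph = 0 <-> phi j = gpi R a / 2 \/ phi j = 3 * gpi R a / 2.
Proof.
rewrite cs_phase_gprod; split=> [/eqP|/(gcos_zero a0) ->]; last by rewrite mul0r.
rewrite mulf_eq0 mulf_eq0 invr_eq0 normr_eq0 (negbTE (gprod_neq0 j)) /= orbF => /eqP.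
exact: gcos_eq0 phi_range.
Qed.

End level.

(** Below the first nonzero exponent motion is straight and each step of the clock formula reads
    ((p^2 + E) s - p^2 s) / E = s. *)
Lemma clock_first (t : R) k : (k <= n)%N -> (forall i, (i < k)%N -> al i = 0%N) ->
  clock n al X0 t p k = t.
Proof.
elim: k => // k ih kn h; rewrite clockS ih ?(ltnW kn) //; last by move=> i ik; apply: h;
  exact: leqW.
rewrite h // /orbit_clock /orbit_x /orbit_p /level_energy /= muln0 expr0.
have := lt0r_neq0 (energy_pos kn) => e0.
by field; rewrite e0.
Qed.

Lemma Rintegral_xi (j : 'I_n) (t : R) : 0 < t ->
  \int[@lebesgue_measure R]_(s in `[0, t])
    (xi alpha (geod alpha x0 (p0phi alpha x0 phi) s) (widx j)) ^+ 2 = clock n al X0 t p j.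
Proof.
move=> t0; have jn := ltnW (ltn_ord j).
have pl : p0phi alpha x0 phi ord0 ord_max != 0.
  by have := p0_last_neq0; rewrite /coords (_ : inord n = ord_max) //; apply: val_inj;
    rewrite /= inordK.
have e : {in `[0, t], forall s, (xi alpha (geod alpha x0 (p0phi alpha x0 phi) s) (widx j)) ^+ 2 =
    weight al (flow_x n al X0 s p) j ^+ 2}.
  move=> s; rewrite in_itv/= => /andP[s0 _]; rewrite (geodE rx pl s0) xi_weight /=; congr (_ ^+ 2).
  apply: weight_eq => i ij; rewrite /coords mxE inordK //.
  by apply: (ltn_trans ij); rewrite ltnS.
transitivity (\int[@lebesgue_measure R]_(s in `[0, t]) (weight al (flow_x n al X0 s p) j ^+ 2)).
  by apply: eq_Rintegral => s; rewrite inE/=; exact: e.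
have xn := x0_riemannian; have pn := p0_last_neq0.
have -> : clock n al X0 t p j = clock n al X0 t p j - clock n al X0 0 p j by rewrite (clock0 xn pn
  jn) subr0.
apply: (@Rintegral_derivative R (fun s => clock n al X0 s p j)) => //.
- by move=> s _; case: (der_flow (alpha_seq_last alpha) xn pn s jn).
- move=> s _; apply: continuousX; exact: (weight_continuous (flow_ham_seq (alpha_seq_last alpha)
  xn pn) jn).
Qed.

Lemma tauj_clock (j : 'I_n) : tauj alpha x0 phi j =
  ereal_inf (EFin @` [set t : R | 0 < t /\ `|gomega alpha x0 phi j| * clock n al X0 t p j =
    gpi R (alpha j)]).
Proof.
rewrite /tauj; congr (ereal_inf (_ @` _)); apply/seteqP; split=> t /= [t0 h]; split => //.
  by rewrite -Rintegral_xi.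
by rewrite Rintegral_xi.
Qed.

Lemma coordsZ (t : R) (k : nat) : coords (t *: p0phi alpha x0 phi) k = t * p k.
Proof. by rewrite /coords mxE. Qed.

Lemma energy_scale (t : R) k : (k <= n.+1)%N ->
  energy n al X0 (coords (t *: p0phi alpha x0 phi)) k = t ^+ 2 * E k.
Proof.
rewrite leq_eqVlt => /orP[/eqP->|]; first by rewrite !energy_end mulr0.
rewrite ltnS; move: k; apply: energy_down; first by rewrite !energy_last coordsZ exprMn.
move=> k kn ih; have hk := ltnW kn.
by rewrite (@energyS R n al X0 _ k hk) (@energyS R n al X0 p k hk) ih coordsZ level_energy_scale.
Qed.

(** The trajectory of the scaled covector at time s is the original one at time t s, so substitution
    in the integral of the squared weight over [0, 1] produces the factor 1 / t. *)
Lemma clock_scale (t : R) k : 0 < t -> (k <= n)%N ->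
  clock n al X0 1 (coords (t *: p0phi alpha x0 phi)) k = clock n al X0 t p k / t.
Proof.
move=> t0; have tn := lt0r_neq0 t0; elim: k => [|k ih] kn; first by rewrite /= divff.
rewrite clockS ih ?(ltnW kn) // coordsZ energy_scale; last by rewrite ltnS ltnW.
have eT : t * (clock n al X0 t p k / t) = clock n al X0 t p k by rewrite mulrC (divfK tn).
rewrite (orbit_clock_scale (x0_riemannian kn) _ _ (energy_pos kn) t0) eT.
by rewrite -clockS.
Qed.

Lemma critical_conj_fun (t : R) : 0 < t ->
  critical_point (expmap alpha x0) (t *: p0phi alpha x0 phi) <->
  exists2 j : 'I_n, alpha j != 0%N &
    conj_fun (alpha j) (phase (alpha j) (X0 j) (p j) (E j.+1)) (`|gomega alpha x0 phi j| * clock n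
      al X0 t p j) = 0.
Proof.
move=> t0; have tn := lt0r_neq0 t0.
set q := t *: _.
have xn := x0_riemannian.
have qn : coords q n != 0 by rewrite coordsZ mulf_neq0 // p0_last_neq0.
have near_q : \forall y \near q, expmap alpha x0 y = xmap al X0 1 y.
  have : \forall y \near q, coords y n != 0.
    by have := differentiable_continuous (dif_coords q n) => /cvgr_neq0; apply.
  apply: filterS => y yn; apply: geodE => //.
  by move: yn; rewrite /coords (_ : inord n = ord_max) //; apply: val_inj; rewrite /= inordK.
have dx := dif_xmap (alpha_seq_last alpha) xn qn 1.
have [de ee] := near_eq_diff near_q dx.
have eJ : jacobian (expmap alpha x0) q = jacobian (xmap al X0 1) q.
  exact: (congr1 (fun f : 'rV[R]_n.+1 -> 'rV[R]_n.+1 => lin1_mx f) ee).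
have on : (1 : R) != 0 by rewrite oner_neq0.
have crit := critical_conj_coef (alpha_seq_last alpha) xn qn on.
have kapE (k : nat) (kn : (k < n)%N) :
    conj_coef (al k) (X0 k) (clock n al X0 1 (coords q) k) (coords q k) (energy n al X0 (coords q)
      k.+1) = 0 <->
    al k != 0%N /\ conj_fun (al k) (phase (al k) (X0 k) (p k) (E k.+1))
      (freq (al k) (X0 k) (p k) (E k.+1) * clock n al X0 t p k) = 0.
  have e1 : clock n al X0 1 (coords q) k = clock n al X0 t p k / t := clock_scale t0 (ltnW kn).
  have e2 : coords q k = t * p k := coordsZ t k.
  have e3 : energy n al X0 (coords q) k.+1 = t ^+ 2 * E k.+1 by apply: energy_scale;
    rewrite ltnS ltnW.
  have Tk : 0 < clock n al X0 t p k := clock_gt0 (alpha_seq_last alpha) xn p0_last_neq0 (ltnW kn)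
    t0.
  rewrite e1 e2 e3; exact: (conj_coef_eq0 (p k) (xn k kn) t0 Tk (energy_pos kn)).
rewrite /critical_point eJ; split=> [[_ /crit[k kn /(kapE k kn)[]]]|[j aj Z]].
  have aE : al k = alpha (Ordinal kn) := alpha_seq_ord alpha (Ordinal kn).
  rewrite aE => aj Z; exists (Ordinal kn); first exact: aj.
  rewrite -(freq_gomega aj); exact: Z.
split; first exact: de.
have aE : al j = alpha j := alpha_seq_ord alpha j.
apply/crit; exists (nat_of_ord j); first exact: ltn_ord.
apply/(kapE j (ltn_ord j)); rewrite aE; split; first exact: aj.
rewrite (freq_gomega aj); exact: Z.
Qed.

Lemma der_conj_fun (a : nat) (f : R) (x : R) : (0 < a)%N ->
  is_derive x (1:R) (conj_fun a f) (- a%:R * gsin a (f + x) ^+ (2 * a).-1 * (x * gcos a f + gsin a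
    f)).
Proof.
move=> a0; have h := derD (derC f x) (derid x).
have h1 := derO (g := fun x => f + x) (der_gcos a0 (f + x)) h.
have h2 := derO (g := fun x => f + x) (der_gsin a0 (f + x)) h.
have h3 := derD (derM (derid x) (derC (gcos a f) x)) (derC (gsin a f) x).
by apply: (der_eq (derB (derM h1 h3) (derM h2 (derC (gcos a f) x)))); ring.
Qed.

End spherical_coordinates.

Theorem mainTheorem4 (R : realType) (n : nat) (alpha : 'I_n -> nat)
    (x0 : 'rV[R]_n.+1) (phi : 'I_n -> R) :
  (0 < n)%N ->
  (exists j : 'I_n, alpha j != 0%N) ->
  riemannian alpha x0 ->
  Rcoord0 alpha phi ->
  [/\ (0 < tau alpha x0 phi)%E,
      (tau alpha x0 phi <= tcon alpha x0 (p0phi alpha x0 phi))%E &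
      (tau alpha x0 phi = tcon alpha x0 (p0phi alpha x0 phi) <->
       exists j : 'I_n, [/\ alpha j != 0%N,
         tau alpha x0 phi = tauj alpha x0 phi j &
         phi j = gpi R (alpha j) / 2 \/ phi j = 3 * gpi R (alpha j) / 2])].
Proof.
move=> _ exJ rx phi0.
have xn := x0_riemannian rx; have pn := p0_last_neq0 rx phi0.
pose J : pred 'I_n := [pred j | alpha j != 0%N].
pose u (j : 'I_n) (t : R) := `|gomega alpha x0 phi j| * clock n (alpha_seq alpha) (coords x0) t
  (coords (p0phi alpha x0 phi)) j.
pose Z (j : 'I_n) (x : R) := conj_fun (alpha j) (phase (alpha j) (coords x0 j) (coords (p0phi
  alpha x0 phi) j) (energy n (alpha_seq alpha) (coords x0) (coords (p0phi alpha x0 phi)) j.+1)) x.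
pose good (j : 'I_n) := phi j = gpi R (alpha j) / 2 \/ phi j = 3 * gpi R (alpha j) / 2.
have tauE : tau alpha x0 phi = ereal_inf ((fun j => ereal_inf (EFin @`
    [set t : R | 0 < t /\ u j t = gpi R (alpha j)])) @` [set j | J j]).
  by rewrite /tau; congr (ereal_inf (_ @` _)); apply/funext => j; rewrite (tauj_clock rx phi0).
have tconE : tcon alpha x0 (p0phi alpha x0 phi) =
    ereal_inf (EFin @` [set t : R | 0 < t /\ exists2 j, J j & Z j (u j t) = 0]).
  rewrite /tcon; congr (ereal_inf (_ @` _)); apply/seteqP; split=> t /= [t0 h]; split => //.
    exact/(critical_conj_fun rx phi0 t0).
  exact/(critical_conj_fun rx phi0 t0).
have a0 j : J j -> (0 < alpha j)%N by rewrite lt0n.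
have xj (j : 'I_n) : alpha j != 0%N -> coords x0 j != 0 by rewrite -alpha_seq_ord; exact: xn.
have [||||||||h1 h2 h3] := @first_times_compare R 'I_n J u (fun j => gpi R (alpha j)) Z good.
- move=> j t Jj; apply: continuousM; first exact: cvg_cst.
  have [hd _ _] := der_flow (alpha_seq_last alpha) xn pn t (ltnW (ltn_ord j)).
  exact: is_derive_continuous hd.
- by move=> j t Jj; exact: is_derive_continuous (der_conj_fun _ _ (a0 j Jj)).
- by move=> j Jj; rewrite /u (clock0 xn pn (ltnW (ltn_ord j))) mulr0.
- move=> j t Jj t0; rewrite /u mulr_gt0 ?(gomega_gt0 rx phi0 Jj) //.
  exact: (clock_gt0 (alpha_seq_last alpha) xn pn (ltnW (ltn_ord j)) t0).
- by move=> j Jj; apply: gpi_gt0; exact: a0.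
- move=> j x Jj x0' Zx; have Ej := energy_pos rx phi0 (ltn_ord j).
  have [hle heq] := conj_fun_eq0 (a0 j Jj) (phase_itv (xj j) (a0 j Jj) _ Ej) x0' Zx.
  by split => // /heq; rewrite (cs_phase_eq0 rx phi0 Jj).
- move=> j Jj gj; apply: conj_fun_pi; first exact: a0.
  by rewrite (cs_phase_eq0 rx phi0 Jj).
(* At the least index of J the clock is time itself, so its threshold is met at time pi_a /
   |omega_j|, which makes [tau] finite. *)
- have [j0 j0n] := exJ.
  have ex : exists k, (k < n)%N && (alpha_seq alpha k != 0%N) by exists j0;
    rewrite ltn_ord alpha_seq_ord.
  have [k /andP[kn ak] kmin] := ex_minnP ex.
  pose j := Ordinal kn; have Jj : J j by rewrite /J /= -alpha_seq_ord.
  have T t : clock n (alpha_seq alpha) (coords x0) t (coords (p0phi alpha x0 phi)) j = t.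
    apply: (clock_first rx phi0); first exact: ltnW.
    move=> i ij; apply/eqP; apply/negPn/negP => ai; have := kmin i.
    by rewrite (ltn_trans ij kn) ai leqNgt ij => /(_ isT).
  have g0 := gomega_gt0 rx phi0 Jj; have q0 := gpi_gt0 R (a0 j Jj).
  exists j, (gpi R (alpha j) / `|gomega alpha x0 phi j|); split => //.
    exact: divr_gt0.
  by rewrite /u T mulrC divfK // gt_eqF.
rewrite tconE; split; [by rewrite tauE|by rewrite tauE|rewrite tauE].
split=> [/h3[j [Jj tj gj]]|[j [Jj tj gj]]].
  by exists j; split => //; rewrite (tauj_clock rx phi0).
by apply/h3; exists j; split => //; rewrite tj (tauj_clock rx phi0).
Qed.
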